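(* Let $\mathcal{A}=\{a_0,\dots,a_{n+1}\}\subset\mathbb{Z}^n$ be a circuit. Let $C\in\mathbb{R}^{n\times(n+2)}$ be a coefficient matrix of rank $n$ with columns $C_0,\dots,C_{n+1}$ such that $\mathbf{0}\in\mathbb{R}_{>0}C_0+\cdots+\mathbb{R}_{>0}C_{n+1}$, and let $\sigma$ be an ordering for $C$. Let $\mu=(\mu_0,\dots,\mu_{k-1})$ be the sequence associated to the strict ordering $\bar\sigma$ induced by $\sigma$. If $n_{\mathcal{A}}(C)$ is finite, then $$n_{\mathcal{A}}(C)\le 1+\operatorname{sgnvar}(\mu).$$
   Context: Notation: $[s]=\{0,1,\dots,s-1\}$. For a finite real sequence $c=(c_0,\dots,c_r)$, $\operatorname{sgnvar}(c)$ is the number of pairs $i<j$ with $c_ic_j<0$ and $c_\ell=0$ for all $i<\ell<j$. Let $\mathcal{A}=\{a_0,\dots,a_{n+1}\}\subset\mathbb{Z}^n$ be an ordered set of cardinality $n+2$ whose convex hull has dimension $n$, and let $A\in\mathbb{Z}^{(n+1)\times(n+2)}$ be the matrix with columns $(1,a_j)$, $j=0,\dots,n+1$. Let $A(j)$ be the square matrix obtained from $A$ by deleting the column indexed by $j$, and put $b_j=(-1)^j\det A(j)$; the vector $(b_0,\dots,b_{n+1})^\top$ spans $\ker A$ (a Gale dual of $A$; any nonzero multiple may be used). $\mathcal{A}$ is a circuit if it is minimally affinely dependent, i.e. all $b_j\neq 0$. For $C=(c_{i,j})\in\mathbb{R}^{n\times(n+2)}$ (columns indexed by $[n+2]$), $n_{\mathcal{A}}(C)$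 denotes the number of solutions in $\mathbb{R}_{>0}^n$, counted with multiplicity, of the system $\sum_{j=0}^{n+1}c_{i,j}x^{a_j}=0$, $i=1,\dots,n$. Let $C$ have rank $n$ and satisfy $\mathbf{0}\in\mathbb{R}_{>0}C_0+\cdots+\mathbb{R}_{>0}C_{n+1}$. Let $P\in\mathbb{R}^{(n+2)\times 2}$ be a matrix whose columns form a basis of $\ker C$, with rows $P_0,\dots,P_{n+1}\in\mathbb{R}^2$ (a Gale dual configuration; it is unique up to linear transformation, and under the condition on $C$ the $P_j$ lie in an open half-plane through the origin). Define the equivalence relation on $[n+2]$ by $i\sim j\iff\det(P_i,P_j)=0$, and let $K_0,\dots,K_{k-1}$ be its equivalence classes. An ordering for $C$ is a permutation $\sigma$ of $[n+2]$ such that for some $\epsilon\in\{-1,1\}$, $\epsilon\det(P_{\sigma_i},P_{\sigma_j})\ge 0$ for all $i<j$. If $K\subset[n+2]$ is a set of representatives of the equivalence classes, the induced strict ordering is the bijection $\bar\sigma:[k]\to K$ listing the elements of $K$ in the order in which their classes occur in $\sigma$, so that $\epsilon\det(P_{\bar\sigma_i},P_{\bar\sigma_j})>0$ for $i<j$. Write $K_{\bar\sigma_\ell}$ for the equivalence class containing $\bar\sigma_\ell$. For $\ell\in[k]$ put $$L_\ell=K_{\bar\sigma_0}\cup\dots\cup K_{\bar\sigma_\ell},\qquad \lambda_\ell=\sum_{j\in K_{\bar\sigma_\ell}}b_j,\qquad \mu_\ell=\sum_{j\in L_\ell}b_j=\lambda_0+\dots+\lambda_\ell.$$ *)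

(* Defs.v *)
From mathcomp Require Import all_boot all_order all_fingroup all_algebra.
From mathcomp Require Import classical_sets reals constructive_ereal ereal esum.
From mathcomp Require Import fraction.
(* The notations of mpoly clash with those of MathComp-Analysis. *)
From mathcomp Require Import -(notations) mpoly.

Set Implicit Arguments.
Unset Strict Implicit.
Unset Printing Implicit Defensive.

Import Order.TTheory GRing.Theory Num.Theory.
Local Open Scope ring_scope.

Definition sgnvar (S : realDomainType) (r : nat) (c : 'I_r -> S) : nat :=
  #|[set ij : 'I_r * 'I_r | [&& (ij.1 < ij.2)%N, c ij.1 * c ij.2 < 0 &
      [forall l : 'I_r, (ij.1 < l < ij.2)%N ==> (c l == 0)]]]|.

(* A point configuration {a_0, ..., a_(n+1)} in Z^n is given by the integer
   matrix a whose columns are the points. *)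
Section Configuration.
Context (n : nat) (a : 'M[int]_(n, n.+2)).

Definition Amat : 'M[int]_(1 + n, n.+2) := col_mx (const_mx 1) a.

Definition bvec (j : 'I_n.+2) : int := (-1) ^+ j * \det (col' j Amat).

(* The dimension of the convex hull is that of the affine hull, whose
   direction space is spanned by the vectors a_j - a_0. *)
Definition conv_dim (R : fieldType) : nat :=
  \rank (\matrix_(k < n, j < n.+2) ((a k j - a k ord0)%:~R : R)).

Definition aff_dependent (R : fieldType) (S : {set 'I_n.+2}) : Prop :=
  exists t : 'I_n.+2 -> R,
    [/\ exists j, t j != 0,
        forall j, j \notin S -> t j = 0,
        \sum_j t j = 0
      & forall k : 'I_n, \sum_j t j * (a k j)%:~R = 0].

Definition circuit (R : fieldType) : Prop :=
  aff_dependent R [set: 'I_n.+2]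
  /\ forall S : {set 'I_n.+2}, S \proper [set: 'I_n.+2] -> ~ aff_dependent R S.

End Configuration.

(* The intersection multiplicity at x of f_1, ..., f_m (rational functions
   regular at x) is dim_R (O_x / (f_1, ..., f_m)), where O_x is the local ring
   of affine n-space at x, seen inside the field of rational functions. *)
Section Multiplicity.
Context (R : realType) (n m : nat).
Local Notation ratfun := {fraction (mpoly n R)}.

Definition in_local_ring (x : 'rV[R]_n) (z : ratfun) : Prop :=
  exists p q : mpoly n R, meval (x 0) q != 0 /\ z = tofrac p / tofrac q.

Definition in_local_ideal (f : 'I_m -> ratfun) (x : 'rV[R]_n) (z : ratfun) :
    Prop :=
  exists h : 'I_m -> ratfun,
    (forall i, in_local_ring x (h i)) /\ z = \sum_i h i * f i.

Definition free_mod_local_ideal (f : 'I_m -> ratfun) (x : 'rV[R]_n) (d : nat)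
    (g : 'I_d -> ratfun) : Prop :=
  forall t : 'I_d -> R,
    in_local_ideal f x (\sum_i tofrac (mpolyC n (t i)) * g i) ->
    forall i, t i = 0.

Definition multiplicity (f : 'I_m -> ratfun) (x : 'rV[R]_n) : \bar R :=
  ereal_sup [set d%:R%:E | d in [set d : nat |
    exists g : 'I_d -> ratfun,
      (forall i, in_local_ring x (g i)) /\ free_mod_local_ideal f x g]]%classic.

End Multiplicity.

Section System.
Context (R : realType) (n : nat) (a : 'M[int]_(n, n.+2)) (C : 'M[R]_(n, n.+2)).

Definition laurent (i : 'I_n) : {fraction (mpoly n R)} :=
  \sum_(j < n.+2) tofrac (mpolyC n (C i j)) *
    \prod_(k < n) tofrac (mpolyX R (mnm1 k)) ^ (a k j).

Definition pos_solution (x : 'rV[R]_n) : Prop :=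
  (forall k, 0 < x 0 k) /\
  forall i : 'I_n, \sum_(j < n.+2) C i j * \prod_(k < n) x 0 k ^ (a k j) = 0.

(* n_A(C), possibly +oo *)
Definition npos : \bar R :=
  (\esum_(x in [set x | pos_solution x]%classic) multiplicity laurent x)%E.

End System.

Section GaleDual.
Context (R : realType) (n : nat).

Definition zero_in_open_cone (C : 'M[R]_(n, n.+2)) : Prop :=
  exists t : 'I_n.+2 -> R,
    (forall j, 0 < t j) /\ \sum_j t j *: col j C = 0.

(* The columns of P form a basis of the (right) kernel of C. *)
Definition gale_dual (C : 'M[R]_(n, n.+2)) (P : 'M[R]_(n.+2, 2)) : Prop :=
  row_free P^T /\ (P^T :=: kermx C^T)%MS.

Context (P : 'M[R]_(n.+2, 2)).

Definition pdet (i j : 'I_n.+2) : R := \det (col_mx (row i P) (row j P)).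

Definition gale_eqv : rel 'I_n.+2 := [rel i j | pdet i j == 0].

Definition gale_class (i : 'I_n.+2) : {set 'I_n.+2} := [set j | gale_eqv i j].

Definition gale_classes : {set {set 'I_n.+2}} :=
  [set gale_class i | i in [set: 'I_n.+2]].

Definition is_ordering (sigma : 'S_n.+2) : Prop :=
  exists2 eps : R, eps = -1 \/ eps = 1 &
    forall i j : 'I_n.+2, (i < j)%N -> 0 <= eps * pdet (sigma i) (sigma j).

Definition representatives (K : {set 'I_n.+2}) : Prop :=
  forall B, B \in gale_classes -> #|K :&: B| = 1%N.

(* sbar lists K in the order in which the classes of its elements occur in
   sigma: the class of sbar i lies, in sigma, before that of sbar j. *)
Definition induced_strict_ordering (sigma : 'S_n.+2) (K : {set 'I_n.+2})
    (sbar : 'I_#|gale_classes| -> 'I_n.+2) : Prop :=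
  [/\ injective sbar,
      [set sbar l | l in [set: 'I_#|gale_classes|]] = K
    & forall i j : 'I_#|gale_classes|, (i < j)%N ->
      forall p q : 'I_n.+2,
        sigma p \in gale_class (sbar i) -> sigma q \in gale_class (sbar j) ->
        (p < q)%N].

Context (a : 'M[int]_(n, n.+2)) (sbar : 'I_#|gale_classes| -> 'I_n.+2).

Definition Lset (l : 'I_#|gale_classes|) : {set 'I_n.+2} :=
  \bigcup_(m < #|gale_classes| | (m <= l)%N) gale_class (sbar m).

Definition mu (l : 'I_#|gale_classes|) : int := \sum_(j in Lset l) bvec a j.

End GaleDual.

(* Main.v *)
From HB Require Import structures.
Require Import Defs.
From mathcomp Require Import all_boot all_order all_fingroup all_algebra.
From mathcomp Require Import finmap ring lra.
From mathcomp Require Import boolp classical_sets cardinality fsbigop reals.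
From mathcomp Require Import constructive_ereal ereal esum normedtype.
From mathcomp Require Import derive realfun sequences exp.
From mathcomp Require Import -(notations) mpoly.
Set Implicit Arguments.
Unset Strict Implicit.
Unset Printing Implicit Defensive.
Import Order.TTheory GRing.Theory Num.Theory.
Import numFieldNormedType.Exports.
Local Open Scope ring_scope.

(** The theorem is true because the system has one degree of freedom left after
elimination of the coefficients, and the remaining equation can be counted by
a Descartes rule.

Reduction to one variable. The vector of monomials [x^{a_j}] of a solution is a
positive vector of [ker C], a plane. In a basis [(t, t th)] of that plane, with
[t] the positive vector provided by the cone condition, it reads
[x^{a_j} = al t_j (1 + th_j s)]: the slopes [th_j] are the Gale dual rows [P_j]
seen as points of a projective line, so that they are equal exactly on the
equivalence classes and increase along the ordering [sigma]. Since [sum b_j = 0]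
and [sum b_j a_j = 0], the parameter [s] satisfies
[prod_j (t_j (1 + th_j s))^{b_j} = 1], and it determines [x] because the
differences of the [a_j] span a lattice of finite index. Clear denominators and
let [F = gale_num - gale_den].

Multiplicities. In the local algebra of the system at [x] every variable is
congruent to its value modulo [s - s0] ([uniformizer]): a power of it is a
product of the units [x^{a_j}], which are functions of [s], and a power of a
unit determines the unit up to its value at the point. As [F] vanishes in this
algebra ([univariate_relation]), it is spanned by the powers of [s - s0] below
the multiplicity of [s0] as a root of [F] ([multiplicity_le_mup]). Finiteness
of the count excludes [F = 0], which would make every admissible [s] a solution
([solution_of_param]).

Counting. By Rolle, [F] has at most one zero more than its logarithmic
derivative [sum_j b_j th_j / (1 + th_j s)]. Summation by parts turns the latter
into a combination of the functions [1 / ((1 + th_l s)(1 + th_{l+1} s))], over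
consecutive classes, whose coefficients are the [mu_l] up to positive factors
and one common sign ([zeros_le_univariate]). Cut that combination at the sign
changes of [mu]: it becomes an alternating sum of positive combinations of
products of inverses of linear forms with slopes in successive intervals. Let
[m] be the first cut. In the affine chart where [1 + th_m s] is constant, such
inverses are monotone, increasing when their slopes are below [th_m] and
decreasing when above; so differentiation in that chart merges the two blocks
around [m] and keeps the shape of the rest. One more application of Rolle per
sign change leaves a single positive block, without zeros
([zeros_le_alternating]). *)

(** * Zeros with multiplicity and Rolle's theorem *)

Definition wronskian (R : comNzRingType) (F D : {poly R}) : {poly R} :=
  F^`() * D - F * D^`().

(** Bounding the total multiplicity over arbitrary families of distinct points
avoids having to enumerate the roots of [F] in [I]. *)
Definition zeros_le (R : realType) (I : pred R) (F : {poly R}) (N : nat) :=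
  forall X : seq R, uniq X -> all I X -> (\sum_(x <- X) mup x F <= N)%N.

Section Rolle.
Context (R : realType).
Implicit Types (F G D W : {poly R}) (a b x : R).

(** Rolle's theorem for [F / D]: the wronskian is the numerator of the
derivative. *)
Lemma rolle_quotient F D a b : a < b ->
  (forall x, a <= x <= b -> D.[x] != 0) -> F.[a] = 0 -> F.[b] = 0 ->
  exists2 c, a < c < b & (wronskian F D).[c] = 0.
Proof.
move=> ab D0 Fa Fb.
have dP (p : {poly R}) (x : R) : is_derive x 1 (horner p) p^`().[x].
  by rewrite derivE derive1E; apply/derivableP/derivable_horner.
have dq x : a <= x <= b -> is_derive x 1 (fun y => F.[y] / D.[y])
    (F.[x] * (- D.[x] ^- 2 * D^`().[x]) + D.[x]^-1 * F^`().[x]).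
  move=> xab.
  exact: is_deriveM (dP F x) (is_deriveV (D0 _ xab) (dP D x)).
have [||| c] := @Rolle R (fun y => F.[y] / D.[y]) a b ab.
- move=> x; rewrite in_itv /= => /andP[ax xb].
  by have [] := dq x (introT andP (conj (ltW ax) (ltW xb))).
- apply: derivable_within_continuous => x; rewrite in_itv /= => xab.
  by have [] := dq x xab.
- by rewrite Fa Fb !mul0r.
rewrite in_itv /= => acb dc; exists c => //.
have cab : a <= c <= b by case/andP: acb => /ltW -> /ltW ->.
have := @derive_val _ _ _ _ _ _ _ (dq c cab).
rewrite (@derive_val _ _ _ _ _ _ _ dc) => /esym h; rewrite /wronskian hornerD hornerN !hornerM.
have := congr1 (fun z => z * D.[c] ^+ 2) h; rewrite mul0r => <-.
by field; apply: D0.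
Qed.

(** Write [F = (X - x)^m H] with [H(x)] nonzero. The wronskian is [(X - x)^(m-1)]
times a polynomial whose value at [x] is [m H(x) D(x)], which does not vanish. *)
Lemma mup_wronskian F D x : F != 0 -> root F x -> D.[x] != 0 ->
  wronskian F D != 0 /\ (mup x F <= (mup x (wronskian F D)).+1)%N.
Proof.
move=> F0 Fx Dx.
have [m [H]] := multiplicity_XsubC F x; rewrite F0 /= => Hx FE.
have m0 : (0 < m)%N.
  by case: m FE => // FE; move: Fx; rewrite FE expr0 mulr1 (negPf Hx).
have mE : mup x F = m by rewrite FE mupMr // mup_XsubCX eqxx.
set L := H * D *+ m + ('X - x%:P) * wronskian H D.
have WE : wronskian F D = ('X - x%:P) ^+ m.-1 * L.
  rewrite /wronskian FE derivM deriv_exp derivXsubC mul1r.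
  have -> : ('X - x%:P) ^+ m = ('X - x%:P) * ('X - x%:P) ^+ m.-1.
    by rewrite -exprS prednK.
  by rewrite /L /wronskian; move: (_ ^+ m.-1) => Y; ring.
have Lx : ~~ root L x.
  rewrite /root /L hornerD hornerMn !hornerM hornerXsubC subrr mul0r addr0 -mulr_natr.
  by rewrite !mulf_neq0 // pnatr_eq0 -lt0n.
have L0 : L != 0 by apply: contraNneq Lx => ->; rewrite root0.
have XE : ('X - x%:P) ^+ m.-1 != 0 by rewrite expf_neq0 // polyXsubC_eq0.
split; first by rewrite WE mulf_neq0.
by rewrite mE WE mupMl // mup_XsubCX eqxx prednK.
Qed.

(** At the zeros of [F] the wronskian loses at most one in multiplicity, and it
has a further zero between any two of them, so in total at most one zero is
lost. The bound on the wronskian is only asked when it is nonzero, because a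
zero wronskian forces [F] to have no zero in [I]. *)
Lemma zeros_le_rolle (I : pred R) F D N :
  (forall a b x, I a -> I b -> a <= x <= b -> I x) ->
  (forall x, I x -> D.[x] != 0) ->
  (wronskian F D != 0 -> zeros_le I (wronskian F D) N) ->
  F != 0 -> zeros_le I F N.+1.
Proof.
move=> Iconv ID WN F0 X uX IX.
set W := wronskian F D in WN *.
pose S := sort <=%O [seq x <- X | root F x].
have SX : (\sum_(x <- S) mup x F = \sum_(x <- X) mup x F)%N.
  rewrite (perm_big _ (permEl (perm_sort _ _))) /= big_filter [RHS](bigID (root F)) /=.
  by rewrite [X in (_ + X)%N]big1 ?addn0 // => x /mupNroot.
rewrite -SX.
have uS : sorted <%O S.
  by rewrite sort_lt_sorted filter_uniq.
have IS : all I S by rewrite (perm_all _ (permEl (perm_sort _ _))) all_filter;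
  apply: sub_all IX => x Ix; apply/implyP.
have rS : all (root F) S.
  by rewrite (perm_all _ (permEl (perm_sort _ _))) filter_all.
case: {SX} S uS IS rS => [|r S] /=; first by rewrite big_nil.
move=> pS /andP[Ir IS] /andP[rr rS].
have [W0 _] := mup_wronskian F0 rr (ID _ Ir).
(* Y interleaves the given zeros with the ones provided by Rolle; keeping it
   sorted and above r makes the induction on the list of zeros go through. *)
suff [Y [pY IY le]] : exists Y, [/\ path <%O r Y, all I Y &
    (\sum_(x <- r :: S) mup x F <= (\sum_(x <- r :: Y) mup x W).+1)%N].
  apply: leq_trans le _; rewrite ltnS; apply: WN => //=; last by rewrite Ir.
  exact: (@lt_sorted_uniq _ _ (r :: Y)).
elim: S r pS Ir IS rr rS => [|r2 S IH] r /=.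
  move=> _ Ir _ rr _; exists [::]; split=> //.
  by rewrite !big_seq1 (mup_wronskian F0 rr (ID _ Ir)).2.
move=> /andP[lt pS] Ir /andP[Ir2 IS] rr /andP[rr2 rS].
have [Y [pY IY le]] := IH r2 pS Ir2 IS rr2 rS.
have Dab x : r <= x <= r2 -> D.[x] != 0 by move=> /(Iconv _ _ _ Ir Ir2) /ID.
have [c /andP[rc cr2] Wc] := rolle_quotient lt Dab (eqP rr) (eqP rr2).
exists [:: c, r2 & Y]; split.
- by rewrite /= rc cr2.
- by rewrite /= Ir2 IY (Iconv r r2) // !ltW.
have h := (mup_wronskian F0 rr (ID _ Ir)).2.
have c1 : (0 < mup c W)%N by rewrite -XsubC_dvd // dvdp_XsubCl; apply/eqP.
rewrite [in X in (X <= _)%N]big_cons; apply: leq_trans (leq_add h le) _.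
rewrite -/W [in X in (_ <= X)%N]big_cons [X in (_ <= (_ + X).+1)%N]big_cons.
by rewrite addSn ltnS leq_add2l -add1n leq_add2r.
Qed.

Lemma zeros_le_weaken (I : pred R) F M N : (M <= N)%N ->
  zeros_le I F M -> zeros_le I F N.
Proof. by move=> MN h X uX IX; apply: leq_trans (h X uX IX) MN. Qed.

Lemma zeros_le_ext (I : pred R) F G N : (forall x, I x -> mup x F = mup x G) ->
  zeros_le I G N -> zeros_le I F N.
Proof.
move=> FG h X uX IX; apply: leq_trans (h X uX IX).
rewrite leq_eqVlt; apply/orP; left; apply/eqP.
by rewrite big_seq [RHS]big_seq; apply: eq_bigr => x /(allP IX) /FG.
Qed.

Lemma zeros_leMl (I : pred R) F D N : D != 0 -> F != 0 ->
  zeros_le I (D * F) N -> zeros_le I F N.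
Proof.
move=> D0 F0 h X uX IX; apply: leq_trans (h X uX IX).
by apply: leq_sum => x _; rewrite mupM // leq_addl.
Qed.

End Rolle.

(** * A Descartes rule for products of inverse linear forms *)

Section Descartes.
Context (R : realType) (T : finType) (th : T -> R).
Implicit Types (F G : {poly R}) (lo hi : R) (d r : nat) (i m : T).

Definition linform i : {poly R} := 1 + (th i)%:P * 'X.
Definition linform_prod : {poly R} := \prod_i linform i.
Definition linform_cofactor i : {poly R} := \prod_(j | j != i) linform j.
Definition linform_dom : pred R := fun s => [forall i, 0 < (linform i).[s]].

Lemma linform_prodE i : linform_prod = linform i * linform_cofactor i.
Proof. by rewrite /linform_prod (bigD1 i). Qed.

Lemma horner_linform i s : (linform i).[s] = 1 + th i * s.
Proof. by rewrite /linform !hornerE. Qed.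

Lemma deriv_linform i : (linform i)^`() = (th i)%:P.
Proof. by rewrite /linform derivD derivM !derivC derivX mul0r !add0r mulr1. Qed.

Lemma linform_gt0 i s : linform_dom s -> 0 < (linform i).[s].
Proof. by move/forallP. Qed.

Lemma linform_dom_convex a b x :
  linform_dom a -> linform_dom b -> a <= x <= b -> linform_dom x.
Proof.
move=> Ia Ib /andP[ax xb]; apply/forallP => i.
have := linform_gt0 i Ia; have := linform_gt0 i Ib; rewrite !horner_linform.
by case: (lerP 0 (th i)) => h; nra.
Qed.

Lemma linform_cofactor_gt0 i s : linform_dom s -> 0 < (linform_cofactor i).[s].
Proof. by move=> Is; rewrite horner_prod prodr_gt0 // => j _; exact: linform_gt0. Qed.

Lemma linform_prod_gt0 s : linform_dom s -> 0 < linform_prod.[s].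
Proof. by move=> Is; rewrite horner_prod prodr_gt0 // => j _; exact: linform_gt0. Qed.

(** A polynomial [F] in [cone lo hi d] stands for the function
[F / linform_prod^d]. In these terms, multiplication by [linform_cofactor i] is
division by [linform i], so the cone consists of the positive combinations of
products of [d] inverses of linear forms with slopes in [[lo, hi]]. *)
Inductive cone lo hi : nat -> {poly R} -> Prop :=
| cone_const c : 0 <= c -> cone lo hi 0 c%:P
| cone_zero d : cone lo hi d 0
| cone_add d F G : cone lo hi d F -> cone lo hi d G -> cone lo hi d (F + G)
| cone_scale d c F : 0 <= c -> cone lo hi d F -> cone lo hi d (c *: F)
| cone_mul d i F : lo <= th i <= hi -> cone lo hi d F ->
    cone lo hi d.+1 (linform_cofactor i * F).

Lemma cone_widen lo hi lo' hi' d F : lo' <= lo -> hi <= hi' ->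
  cone lo hi d F -> cone lo' hi' d F.
Proof.
move=> ll hh; elim=> {d F} [c c0|d|d F G _ IF _ IG|d c F c0 _ IF|d i F lohi _ IF].
- exact: cone_const.
- exact: cone_zero.
- exact: cone_add.
- exact: cone_scale.
- by apply: cone_mul => //; lra.
Qed.

Lemma cone_pos lo hi d F : cone lo hi d F ->
  F = 0 \/ forall s, linform_dom s -> 0 < F.[s].
Proof.
elim=> {d F} [c c0|d|d F G _ IF _ IG|d c F c0 _ IF|d i F lohi _ IF].
- have [->|cN] := eqVneq c 0; first by left.
  by right=> s _; rewrite hornerC lt_neqAle eq_sym cN.
- by left.
- case: IF IG => [->|pF] [->|pG]; rewrite ?addr0 ?add0r; [by left|by right..|].
  by right=> s Is; rewrite hornerD addr_gt0 ?pF ?pG.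
- case: IF => [->|pF]; first by left; rewrite scaler0.
  have [->|cN] := eqVneq c 0; first by left; rewrite scale0r.
  by right=> s Is; rewrite hornerZ mulr_gt0 ?pF // lt_neqAle eq_sym cN.
- case: IF => [->|pF]; first by left; rewrite mulr0.
  by right=> s Is; rewrite hornerM mulr_gt0 ?pF ?linform_cofactor_gt0.
Qed.

(** The derivative of [F / linform_prod^d] in the affine chart of the projective
line where [linform m] is constant, again read as the numerator of a fraction,
now with denominator [linform_prod^(d.+1)]; see [wronskian_chart]. *)
Definition chart_deriv m d F : {poly R} :=
  linform m * F^`() * linform_prod +
  F * ((linform m)^`() * linform_prod - linform m * linform_prod^`()) *+ d.

Lemma chart_derivD m d F G :
  chart_deriv m d (F + G) = chart_deriv m d F + chart_deriv m d G.
Proof. by rewrite /chart_deriv derivD; ring. Qed.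

Lemma chart_derivN m d F : chart_deriv m d (- F) = - chart_deriv m d F.
Proof. by rewrite /chart_deriv derivN; ring. Qed.

Lemma chart_deriv0 m d : chart_deriv m d 0 = 0.
Proof. by rewrite /chart_deriv deriv0 mulr0 !mul0r mul0rn addr0. Qed.

Lemma chart_derivZ m d c F : chart_deriv m d (c *: F) = c *: chart_deriv m d F.
Proof. by rewrite /chart_deriv derivZ -!mul_polyC; ring. Qed.

(** Leibniz rule: in the chart of [m] the derivative of [1 / linform i] is
[(th m - th i) / linform i ^ 2], whose sign only depends on the position of
[th i] with respect to [th m]. *)
Lemma chart_deriv_mul m d i F : chart_deriv m d.+1 (linform_cofactor i * F) =
  linform_cofactor i * chart_deriv m d F +
  (th m - th i) *: (linform_cofactor i * (linform_cofactor i * F)).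
Proof.
rewrite /chart_deriv (linform_prodE i) !derivM !deriv_linform -!mul_polyC polyCB.
by rewrite /linform; ring.
Qed.

Lemma chart_deriv_cone s m lo hi d F : cone lo hi d F ->
  (forall i, lo <= th i <= hi -> 0 <= s * (th m - th i)) ->
  cone lo hi d.+1 (s *: chart_deriv m d F).
Proof.
move=> cF hs; elim: cF => {d F} [c c0|d|d F G _ IF _ IG|d c F c0 _ IF|d i F lohi cF IF].
- rewrite /chart_deriv derivC mulr0 mul0r mulr0n addr0 scaler0; exact: cone_zero.
- rewrite chart_deriv0 scaler0; exact: cone_zero.
- rewrite chart_derivD scalerDr; exact: cone_add.
- rewrite chart_derivZ scalerA mulrC -scalerA; exact: cone_scale.
- rewrite chart_deriv_mul scalerDr scalerA scalerAr.
  apply: cone_add; first exact: cone_mul.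
  by apply: cone_scale; [exact: hs|do 2!apply: cone_mul => //].
Qed.

(** Alternating sums of [r.+1] elements of cones over successive intervals,
starting at [lo], the breakpoints being among the slopes [th m]. *)
Inductive alternating lo d : nat -> {poly R} -> Prop :=
| alternating_cone hi F : cone lo hi d F -> alternating lo d 0 F
| alternating_cons m F G r : cone lo (th m) d F -> alternating (th m) d r G -> lo <= th m ->
    alternating lo d r.+1 (F - G).

Lemma alternating_add lo m d r F G : lo <= th m -> cone lo (th m) d F ->
  alternating (th m) d r G -> alternating lo d r (F + G).
Proof.
move=> lm cF; case=> [hi {}G cG|m' G1 G2 {}r cG aG mm].
  apply: (@alternating_cone _ _ (Num.max hi (th m))); apply: cone_add.
    by apply: cone_widen cF; rewrite // le_max lexx orbT.
  by apply: cone_widen cG; rewrite // le_max lexx.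
rewrite addrA; apply: alternating_cons aG _; last exact: le_trans mm.
by apply: cone_add; [apply: cone_widen cF|apply: cone_widen cG].
Qed.

Lemma chart_deriv_alternating m lo d r F : th m <= lo -> alternating lo d r F ->
  alternating lo d.+1 r (- chart_deriv m d F).
Proof.
move=> ml aF; elim: aF ml => {lo d r F} [lo d hi F cF|lo d m' F G r cF _ IH lm] ml.
  apply: (@alternating_cone _ _ hi); rewrite -scaleN1r; apply: chart_deriv_cone => // i.
  by move=> /andP[? ?]; lra.
rewrite chart_derivD chart_derivN opprD; apply: alternating_cons (IH (le_trans ml lm)) lm.
rewrite -scaleN1r; apply: chart_deriv_cone => // i.
by move=> /andP[? ?]; lra.
Qed.

(** Below the breakpoint the derivative keeps the sign of a block, above it the
sign is reversed: the first two blocks, of opposite signs, become one. *)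
Lemma chart_deriv_merge m lo d r F G : lo <= th m -> cone lo (th m) d F ->
  alternating (th m) d r G -> alternating lo d.+1 r (chart_deriv m d (F - G)).
Proof.
move=> lm cF aG; rewrite chart_derivD chart_derivN.
apply: (alternating_add lm); last exact: chart_deriv_alternating.
rewrite -[chart_deriv _ _ _]scale1r; apply: chart_deriv_cone => // i.
by move=> /andP[? ?]; lra.
Qed.

Lemma wronskian_chart m d F :
  wronskian (linform m ^+ d.+1 * F) (linform_prod ^+ d.+1) =
  linform m ^+ d * linform_prod ^+ d * chart_deriv m d.+1 F.
Proof.
rewrite /wronskian /chart_deriv derivM !deriv_exp /= deriv_linform !exprS.
by move: (_ ^+ d) (linform_prod ^+ d) => Y Z; ring.
Qed.

Lemma linform_neq0 m : linform m != 0.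
Proof.
apply/eqP => /(congr1 (horner^~ 0)) /eqP.
by rewrite horner_linform horner0 mulr0 addr0 oner_eq0.
Qed.

Lemma linform_prod_neq0 : linform_prod != 0.
Proof. by apply/prodf_neq0 => i _; exact: linform_neq0. Qed.

(** Multiplying by a power of [linform m] does not change the zeros in the domain
and moves to the chart of the first breakpoint [m], where the derivative has one
block less. With a single block left the function is positive. *)
Theorem zeros_le_alternating lo d r F : alternating lo d.+1 r F -> F != 0 ->
  zeros_le linform_dom F r.
Proof.
elim: r lo d F => [|r IH] lo d F aF F0.
  inversion aF as [hi F' cF|]; subst.
  have [FE|pF] := cone_pos cF; first by rewrite FE eqxx in F0.
  move=> X uX IX; rewrite big_seq big1 // => x xX.
  apply: mupNroot; rewrite /root gt_eqF // pF //.
  by move/allP: IX; apply.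
inversion aF as [|m F1 G r' cF aG lm]; subst.
have qm0 := expf_neq0 d.+1 (linform_neq0 m).
apply: (zeros_leMl qm0) => //.
apply: (@zeros_le_rolle _ _ _ (linform_prod ^+ d.+1)) => //.
- exact: linform_dom_convex.
- by move=> x Ix; rewrite horner_exp expf_neq0 // gt_eqF // linform_prod_gt0.
- rewrite wronskian_chart mulf_eq0 negb_or => /andP[_ cW0].
  apply: zeros_le_ext (IH _ _ _ (chart_deriv_merge lm cF aG) cW0) => x Ix.
  rewrite mupMr // /root hornerM !horner_exp mulf_neq0 // expf_neq0 // gt_eqF //.
    exact: linform_gt0.
  exact: linform_prod_gt0.
- by rewrite mulf_neq0.
Qed.

End Descartes.

(** * Sign variations and alternating sums *)

Section SignVariation.
Context (R : realType) (T : finType) (th : T -> R) (K d : nat).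
Context (c : 'I_K.+1 -> int) (g : nat -> {poly R}) (p : nat -> T).
Hypothesis p_mono : forall i j, (i <= j)%N -> th (p i) <= th (p j).
Hypothesis g_cone : forall l, cone th (th (p l)) (th (p l.+1)) d (g l).

Let cn l : int := c (inord l).
Let tail m : {poly R} := \sum_(m <= l < K) (cn l)%:~R *: g l.
Let changes m := [set ij : 'I_K.+1 * 'I_K.+1 | (m <= ij.1)%N &&
  [&& (ij.1 < ij.2)%N, c ij.1 * c ij.2 < 0 &
      [forall l : 'I_K.+1, (ij.1 < l < ij.2)%N ==> (c l == 0)]]].

(** The blocks are built from the last term to the first, since an alternating
sum grows at its lower end. The index [q] is that of the first nonzero
coefficient of the tail; a nonzero coefficient put before it either enlarges
the first block or, if its sign differs, opens a new one, and then the pair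
[(m, q)] is a new sign change. *)
Lemma tail_alternating m : (m <= K)%N ->
  (forall l, (m <= l < K)%N -> cn l = 0) \/
  exists2 q, [/\ (m <= q < K)%N, cn q != 0 &
                 forall l, (m <= l < q)%N -> cn l = 0] &
    exists2 r, (r <= #|changes m|)%N &
      alternating th (th (p q)) d r (Num.sg (cn q)%:~R *: tail m).
Proof.
move=> mK; rewrite -(subKn mK); move: (leq_subr m K).
elim: (K - m)%N => {m mK} [|n IH] nK.
  by left=> l; rewrite subn0; case: leqP => // ? /ltn_geF ->.
set m := (K - n.+1)%N.
have mE : (K - n = m.+1)%N by rewrite /m subnSK.
have mK : (m < K)%N by rewrite -mE leq_subr.
have tE : tail m = (cn m)%:~R *: g m + tail m.+1 by rewrite /tail big_ltn.
have chS : changes m.+1 \subset changes m.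
  by apply/fintype.subsetP => ij; rewrite !inE => /andP[/ltnW -> ->].
have sgE (a : int) : Num.sg a%:~R * a%:~R = `|a%:~R| :> R by rewrite normrEsg.
move: (IH (ltnW nK)); rewrite mE => {}IH.
have [c0|cN0] := eqVneq (cn m) 0.
  case: IH => [z|[q [/andP[mq qK] cq z] [r rV ar]]].
    left=> l /andP[]; rewrite leq_eqVlt => /orP[/eqP <- //|ml lK].
    by apply: z; rewrite ml.
  right; exists q; first split => //; first by rewrite qK ltnW.
    move=> l /andP[]; rewrite leq_eqVlt => /orP[/eqP <- //|ml lq].
    by apply: z; rewrite ml.
  exists r; first exact: leq_trans rV (subset_leq_card chS).
  by rewrite tE c0 scale0r add0r.
right; exists m; first by split=> //; [rewrite leqnn|move=> l; case: leqP => // ? /ltn_geF ->].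
have cm : cone th (th (p m)) (th (p m.+1)) d (`|(cn m)%:~R| *: g m).
  exact: cone_scale.
case: IH => [z|[q [/andP[mq qK] cq z] [r rV ar]]].
  exists 0%N => //; apply: (@alternating_cone _ _ _ _ _ (th (p m.+1))).
  rewrite tE [tail _]big_nat_cond big1 ?addr0 ?scalerA ?sgE //.
  by move=> l /andP[/z -> _]; rewrite scale0r.
have mq1 := p_mono mq; have mq2 := p_mono (ltnW mq).
have cm' : cone th (th (p m)) (th (p q)) d (`|(cn m)%:~R| *: g m).
  exact: cone_widen cm.
have [same|opp] := boolP (Num.sg (cn m)%:~R == Num.sg (cn q)%:~R :> R).
  exists r; first exact: leq_trans rV (subset_leq_card chS).
  rewrite tE scalerDr scalerA sgE (eqP same).
  exact: alternating_add cm' ar.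
have sgN : Num.sg (cn m)%:~R = - Num.sg (cn q)%:~R :> R.
  have sg1 (a : int) : a != 0 -> Num.sg (a%:~R : R) = 1 \/ Num.sg (a%:~R : R) = -1.
    by rewrite -(intr_eq0 R); case: sgrP => // *; auto.
  by move: opp; case: (sg1 _ cN0) (sg1 _ cq) => -> [->|->]; rewrite ?eqxx ?opprK.
have cmq : cn m * cn q < 0.
  rewrite -(ltr_int R) rmorphM /= -sgr_lt0 sgrM sgN.
  by rewrite mulNr -expr2 sqr_sg intr_eq0 cq oppr_lt0 ltr01.
exists r.+1; last first.
  rewrite tE scalerDr scalerA sgE [X in _ + X *: _]sgN scaleNr.
  exact: alternating_cons cm' ar _.
apply: leq_ltn_trans rV _; apply: proper_card; apply/properP; split => //.
have mo : (m < K.+1)%N by rewrite ltnS ltnW.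
have qo : (q < K.+1)%N by rewrite ltnS ltnW.
exists (Ordinal mo, Ordinal qo); rewrite !inE /= ?ltnn //.
rewrite leqnn mq /=; apply/andP; split.
  by move: cmq; congr (c _ * c _ < 0); apply: val_inj; rewrite /= inordK.
apply/forallP => l; apply/implyP => /= /z; rewrite /cn => zl.
by apply/eqP; rewrite -zl; congr c; apply: val_inj; rewrite /= inordK.
Qed.

Lemma alternating_sum : let E := \sum_(l < K) (c (inord l))%:~R *: g l in
  E = 0 \/ exists lo, exists2 s : R, s != 0 & exists2 r, (r <= sgnvar c)%N &
  alternating th lo d r (s *: E).
Proof.
move=> E.
have EE : E = tail 0 by rewrite /tail big_mkord.
rewrite EE; case: (tail_alternating (leq0n K)) => [z|[q [_ cq _] [r rV ar]]].
  left; rewrite /tail big_nat_cond big1 // => l /andP[/z -> _].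
  by rewrite scale0r.
right; exists (th (p q)), (Num.sg (cn q)%:~R); first by rewrite sgr_eq0 intr_eq0.
by exists r.
Qed.

End SignVariation.

(** * The univariate equation and its number of zeros *)

Definition pos_part (z : int) : nat := if z is Posz n then n else 0%N.

Lemma pos_partB z : (pos_part z)%:Z - (pos_part (- z))%:Z = z.
Proof.
case: z => [[|n]|n] //=; first by rewrite subr0.
by rewrite sub0r NegzE.
Qed.

Section Univariate.
Context (R : realType) (T : finType) (th t : T -> R) (b : T -> int).
Hypothesis t_gt0 : forall j, 0 < t j.

Definition gale_form j : {poly R} := t j *: linform th j.
Definition gale_monomial (e : T -> nat) : {poly R} := \prod_j gale_form j ^+ e j.
(** The equation [prod_j (gale_form j)^(b j) = 1] is [gale_num = gale_den]: the
factors of negative exponent are moved to the other side. *)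
Definition gale_num := gale_monomial (fun j => pos_part (b j)).
Definition gale_den := gale_monomial (fun j => pos_part (- b j)).

Lemma gale_form_gt0 j s : linform_dom th s -> 0 < (gale_form j).[s].
Proof. by move=> Is; rewrite hornerZ mulr_gt0 ?linform_gt0. Qed.

Lemma gale_monomial_gt0 e s : linform_dom th s -> 0 < (gale_monomial e).[s].
Proof.
move=> Is; rewrite horner_prod prodr_gt0 // => j _.
by rewrite horner_exp exprn_gt0 // gale_form_gt0.
Qed.

(** Logarithmic derivative of a product of powers of linear forms. *)
Lemma deriv_gale_monomial e : (gale_monomial e)^`() * linform_prod th =
  gale_monomial e * \sum_j (th j *+ e j) *: linform_cofactor th j.
Proof.
rewrite /gale_monomial.
apply: (big_ind2 (fun p w => p^`() * linform_prod th = p * w)).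
- by rewrite derivC mul0r mulr0.
- move=> p w p' w' h h'.
  by rewrite derivM mulrDl mulrAC h -mulrA h' mulrDr; ring.
move=> j _; case: (e j) => [|n]; first by rewrite expr0 derivC mul0r mulr0n scale0r mulr0.
rewrite (linform_prodE th j) deriv_exp derivZ deriv_linform /=.
rewrite exprS /gale_form -!mul_polyC polyCMn.
move: (_ ^+ n) => Y; ring.
Qed.

Lemma wronskian_gale : wronskian gale_num gale_den * linform_prod th =
  gale_num * gale_den * \sum_j ((b j)%:~R * th j) *: linform_cofactor th j.
Proof.
transitivity (gale_num * gale_den *
   (\sum_j (th j *+ pos_part (b j)) *: linform_cofactor th j -
    \sum_j (th j *+ pos_part (- b j)) *: linform_cofactor th j)).
  rewrite mulrBr /wronskian mulrBl mulrAC deriv_gale_monomial.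
  by rewrite -[X in _ - X]mulrA deriv_gale_monomial -/gale_num -/gale_den; ring.
congr (_ * _); rewrite -sumrB; apply: eq_bigr => j _; rewrite -scalerBl.
by congr (_ *: _); rewrite -{3}[b j]pos_partB rmorphB /= mulrBl !mulr_natl.
Qed.

Lemma linform_cofactor_congr i j :
  th i = th j -> linform_cofactor th i = linform_cofactor th j.
Proof.
move=> e; apply: (mulfI (linform_neq0 th i)); rewrite -linform_prodE.
by rewrite (linform_prodE th j) /linform e.
Qed.

End Univariate.

Definition class_partial_sum (T : finType) (b : T -> int) (k : nat) (cl : T -> 'I_k)
  (l : 'I_k) : int := \sum_(j | (cl j <= l)%N) b j.

Section UnivariateBound.
Context (R : realType) (T : finType) (th t : T -> R) (b : T -> int).
Hypothesis t_gt0 : forall j, 0 < t j.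
Hypothesis b_sum : \sum_j b j = 0.

Lemma sum_by_parts (K : nat) (cl : T -> 'I_K.+1) (u : nat -> {poly R}) :
  \sum_j (b j)%:~R *: u (cl j) =
  \sum_(l < K) (class_partial_sum b cl (inord l))%:~R *: (u l - u l.+1).
Proof.
transitivity (\sum_j \sum_(l < K | (cl j <= l)%N) (b j)%:~R *: (u l - u l.+1)).
  transitivity (\sum_j ((b j)%:~R *: u (cl j) - (b j)%:~R *: u K)).
    rewrite sumrB -scaler_suml -(raddf_sum (intmul 1)) b_sum.
    by rewrite scale0r subr0.
  apply: eq_bigr => j _; rewrite -scaler_sumr -scalerBr; congr (_ *: _).
  have cK : (cl j <= K)%N by rewrite -ltnS.
  rewrite -[LHS]opprB -(telescope_sumr u cK) -sumrN big_geq_mkord.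
  by apply: eq_bigr => l _; rewrite opprB.
rewrite (exchange_big_dep predT) //=; apply: eq_bigr => l _.
rewrite -scaler_suml -(raddf_sum (intmul 1)) /class_partial_sum; congr (_%:~R *: _).
by apply: eq_bigl => j; rewrite inordK // ltnS ltnW.
Qed.

(** [rep] chooses one index in each class of equal slopes, the classes being
listed by [cl] in increasing order of slope. By [wronskian_gale] and summation
by parts, the derivative of the logarithm of [gale_num / gale_den] is, up to
positive factors and a common sign, a sum over consecutive classes with
coefficients the partial sums of [b], to which [alternating_sum] applies. *)
Theorem zeros_le_univariate (k : nat) (cl : T -> 'I_k) (rep : 'I_k -> T) :
  (forall j, th (rep (cl j)) = th j) ->
  (forall i j : 'I_k, (i <= j)%N -> th (rep i) <= th (rep j)) ->
  gale_num th t b - gale_den th t b != 0 ->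
  zeros_le (linform_dom th) (gale_num th t b - gale_den th t b)
    (sgnvar (class_partial_sum b cl)).+1.
Proof.
case: k => [|K] in cl rep *.
  move=> _ _; have noT (j : T) : False by case: (cl j).
  by rewrite /gale_num /gale_den /gale_monomial !big1 ?subrr ?eqxx // => j; case: (noT j).
move=> th_rep rep_mono F0.
set A := gale_num th t b in F0 *; set B := gale_den th t b in F0 *.
have WE : wronskian (A - B) B = wronskian A B by rewrite /wronskian derivB; ring.
apply: (@zeros_le_rolle _ _ _ B) => //.
- exact: linform_dom_convex.
- by move=> x Ix; rewrite gt_eqF // gale_monomial_gt0.
rewrite WE => W0.
(* Truncation at K keeps the slopes nondecreasing on all of nat. *)
pose p l := rep (inord (minn l K)).
have p_mono i j : (i <= j)%N -> th (p i) <= th (p j).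
  move=> ij; apply: rep_mono.
  by rewrite !inordK ?ltnS ?geq_minr // leq_min geq_minr geq_min ij.
(* Up to sign, the numerator over linform_prod ^+ 2 of the difference of two
   consecutive terms th / linform, which is
   (th_l - th_(l+1)) / (linform_l * linform_(l+1)). *)
pose g l := (th (p l.+1) - th (p l)) *:
  (linform_cofactor th (p l) * (linform_cofactor th (p l.+1) * 1)).
have g_cone l : cone th (th (p l)) (th (p l.+1)) 2 (g l).
  have h := p_mono _ _ (leqnSn l).
  apply: cone_scale; first by rewrite subr_ge0.
  by do 2!(apply: cone_mul; first by rewrite h lexx); apply: cone_const.
pose E := \sum_(l < K) (class_partial_sum b cl (inord l))%:~R *: g l.
have WqE : wronskian A B * (linform_prod th * linform_prod th) = A * B * - E.
  rewrite mulrA wronskian_gale -[LHS]mulrA; congr (_ * _).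
  pose u l := th (p l) *: (linform_cofactor th (p l) * linform_prod th).
  transitivity (\sum_j (b j)%:~R *: u (cl j)).
    rewrite mulr_suml; apply: eq_bigr => j _.
    have pE : p (cl j) = rep (cl j).
      rewrite /p; congr rep; apply: val_inj.
      have cK : (cl j <= K)%N by rewrite -ltnS.
      by rewrite (minn_idPl cK) /= inordK.
    rewrite /u pE th_rep (linform_cofactor_congr (th_rep j)).
    by rewrite -scalerA !scalerAl.
  rewrite sum_by_parts /E -sumrN; apply: eq_bigr => l _; rewrite -[RHS]scalerN.
  congr (_ *: _); rewrite /u /g mulr1.
  rewrite {1}(linform_prodE th (p l.+1)) (linform_prodE th (p l)).
  rewrite -!mul_polyC /linform polyCB; ring.
have A0 x : linform_dom th x -> 0 < A.[x] by exact: gale_monomial_gt0.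
have B0 x : linform_dom th x -> 0 < B.[x] by exact: gale_monomial_gt0.
have qq0 := linform_prod_neq0 th.
have E0 : E != 0.
  apply: contraNneq W0 => E0; move/eqP: WqE.
  by rewrite E0 oppr0 mulr0 mulf_eq0 mulf_eq0 (negPf qq0) !orbF => ->.
have [/eqP|[lo [s s0 [r rV aE]]]] := alternating_sum (class_partial_sum b cl) p_mono g_cone.
  by rewrite -/E (negPf E0).
rewrite -/E in aE.
have sE0 : s *: E != 0 by rewrite scaler_eq0 negb_or s0.
apply: zeros_le_ext (zeros_le_weaken rV (zeros_le_alternating aE sE0)) => x Ix.
have qx : ~~ root (linform_prod th * linform_prod th) x.
  by rewrite rootM orbb /root gt_eqF // linform_prod_gt0.
rewrite -(mupMl _ qx) WqE mupMr; last by rewrite rootM /root !gt_eqF ?A0 ?B0.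
by rewrite -scaleN1r -!mul_polyC !mupMr // /root hornerC ?oppr_eq0 ?oner_eq0.
Qed.

End UnivariateBound.

(** * Germs and congruences modulo an ideal *)

(** [germ z c] reads: [z] belongs to a local subring of [K], in which [R] embeds
by [iota], and its value in the residue field [R] is [c]. Units are the elements
with nonzero value. A relation is used because the value is defined on the
subring only. *)
Record evaluation (R K : fieldType) (iota : R -> K) (germ : K -> R -> Prop) : Prop := {
  germC : forall c, germ (iota c) c;
  germD : forall z c z' c', germ z c -> germ z' c' -> germ (z + z') (c + c');
  germM : forall z c z' c', germ z c -> germ z' c' -> germ (z * z') (c * c');
  germV : forall z c, c != 0 -> germ z c -> germ z^-1 c^-1;
  germ_neq0 : forall z c, germ z c -> c != 0 -> z != 0 }.

Section Germs.
Context (R K : fieldType) (iota : {rmorphism R -> K}) (germ : K -> R -> Prop).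
Hypothesis gP : evaluation iota germ.
Let germC := germC gP.
Let germD := germD gP.
Let germM := germM gP.
Let germV := germV gP.
Let germ_neq0 := germ_neq0 gP.

Definition regular z := exists c, germ z c.

Definition ideal (I : K -> Prop) := [/\ I 0, forall u v, I u -> I v -> I (u + v)
  & forall h u, regular h -> I u -> I (h * u)].

Lemma germ0 : germ 0 0. Proof. by rewrite -[X in germ X](rmorph0 iota). Qed.
Lemma germ1 : germ 1 1. Proof. by rewrite -[X in germ X](rmorph1 iota). Qed.

Lemma germN z c : germ z c -> germ (- z) (- c).
Proof.
move=> h; rewrite -mulN1r -[X in germ _ X]mulN1r; apply: germM => //.
by rewrite -(rmorph1 iota) -rmorphN.
Qed.

Lemma germXn z c n : germ z c -> germ (z ^+ n) (c ^+ n).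
Proof.
by move=> h; elim: n => [|n IH]; rewrite ?expr0 ?exprS; [exact: germ1|exact: germM].
Qed.

Lemma germXz z c (m : int) : c != 0 -> germ z c -> germ (z ^ m) (c ^ m).
Proof.
move=> c0 h; case: m => n; first exact: germXn.
by apply: germV; [rewrite expf_neq0|exact: germXn].
Qed.

Lemma germ_prod (T : Type) (r : seq T) (P : pred T) (z : T -> K) (c : T -> R) :
  (forall i, P i -> germ (z i) (c i)) ->
  germ (\prod_(i <- r | P i) z i) (\prod_(i <- r | P i) c i).
Proof. by move=> h; apply: (big_ind2 germ); [exact: germ1|move=> *; exact: germM|]. Qed.

Lemma germ_sum (T : Type) (r : seq T) (P : pred T) (z : T -> K) (c : T -> R) :
  (forall i, P i -> germ (z i) (c i)) ->
  germ (\sum_(i <- r | P i) z i) (\sum_(i <- r | P i) c i).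
Proof. by move=> h; apply: (big_ind2 germ); [exact: germ0|move=> *; exact: germD|]. Qed.

Lemma germ_horner (p : {poly R}) s s0 : germ s s0 ->
  germ (map_poly iota p).[s] p.[s0].
Proof.
move=> h; elim/poly_ind: p => [|p c IH]; first by rewrite rmorph0 !horner0; exact: germ0.
rewrite rmorphD rmorphM /= map_polyX map_polyC !hornerMXaddC.
by apply: germD; [exact: germM|exact: germC].
Qed.

Section Congruence.
Context (I : K -> Prop).
Hypothesis idealI : ideal I.

Let I0 : I 0. Proof. by case: idealI. Qed.
Let ID u v : I u -> I v -> I (u + v). Proof. by case: idealI => _ h _; apply: h. Qed.
Let IM h u : regular h -> I u -> I (h * u). Proof. by case: idealI => _ _; apply. Qed.

Lemma ideal_opp u : I u -> I (- u).
Proof. by move=> Iu; rewrite -mulN1r; apply: IM => //; exists (- 1); exact/germN/germ1. Qed.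

Lemma congrM u v u' v' : regular u -> regular v' ->
  I (u - u') -> I (v - v') -> I (u * v - u' * v').
Proof.
move=> ru rv' h h'; rewrite (_ : _ - _ = u * (v - v') + v' * (u - u')); last by ring.
by apply: ID; apply: IM.
Qed.

Lemma congrXn u v c d n : germ u c -> germ v d -> I (u - v) -> I (u ^+ n - v ^+ n).
Proof.
move=> gu gv h; elim: n => [|n IH]; first by rewrite !expr0 subrr.
by rewrite !exprS; apply: congrM => //; [exists c|exists (d ^+ n); exact: germXn].
Qed.

Lemma congrXz u v c d (m : int) : c != 0 -> d != 0 -> germ u c -> germ v d ->
  I (u - v) -> I (u ^ m - v ^ m).
Proof.
move=> c0 d0 gu gv h; case: m => n; first exact: congrXn gu gv h.
rewrite !NegzE -!exprnN.
have h' := congrXn n.+1 gv gu (_ : I (v - u)).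
rewrite (_ : _ - _ = (u ^+ n.+1)^-1 * (v ^+ n.+1)^-1 * (v ^+ n.+1 - u ^+ n.+1)).
  apply: IM; last by apply: h'; rewrite -opprB; exact: ideal_opp.
  exists ((c ^+ n.+1)^-1 * (d ^+ n.+1)^-1).
  by apply: germM; apply: germV; rewrite ?expf_neq0 //; exact: germXn.
have uN : u ^+ n.+1 != 0 by rewrite expf_neq0 // (germ_neq0 gu).
have vN : v ^+ n.+1 != 0 by rewrite expf_neq0 // (germ_neq0 gv).
by field; rewrite uN vN.
Qed.

Lemma congr_prod (T : Type) (r : seq T) (u v : T -> K) :
  (forall i, regular (u i)) -> (forall i, regular (v i)) ->
  (forall i, I (u i - v i)) ->
  I (\prod_(i <- r) u i - \prod_(i <- r) v i).
Proof.
move=> ru rv h; elim: r => [|i r IH]; first by rewrite !big_nil subrr.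
rewrite !big_cons; apply: congrM => //.
have [d hd] := choice rv.
by exists (\prod_(j <- r) d j); apply: germ_prod.
Qed.

End Congruence.

Lemma ideal_adjoin (I : K -> Prop) (e : K) : ideal I ->
  ideal (fun z => exists2 w, regular w & I (z - e * w)).
Proof.
case=> I0 ID IM; split.
- by exists 0; [exists 0; exact: germ0|rewrite mulr0 subr0].
- move=> u v [w [c hw] Iu] [w' [c' hw'] Iv]; exists (w + w').
    by exists (c + c'); exact: germD.
  by rewrite (_ : _ - _ = (u - e * w) + (v - e * w')); [exact: ID|ring].
- move=> h u [d hd] [w [c hw] Iu]; exists (h * w).
    by exists (d * c); exact: germM.
  by rewrite (_ : _ - _ = h * (u - e * w)); [apply: IM => //; exists d|ring].
Qed.

(** If every element is congruent to its value modulo [e], substituting this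
congruence into its own remainder [M] times expands any element in powers of
[e]; the last remainder is a multiple of [e ^+ M]. This replaces Nakayama's
lemma for a principal maximal ideal. *)
Lemma nilpotent_span (I : K -> Prop) (e : K) M : ideal I -> germ e 0 ->
  (forall z c, germ z c -> exists2 w, regular w & I (z - iota c - e * w)) ->
  I (e ^+ M) ->
  forall z, regular z ->
  exists c : 'I_M -> R, I (z - \sum_(i < M) iota (c i) * e ^+ i).
Proof.
move=> idI ge step eM z rz; have [I0 ID IM] := idI.
suff [c [w rw h]] : exists c : 'I_M -> R, exists2 w, regular w &
    I (z - \sum_(i < M) iota (c i) * e ^+ i - e ^+ M * w).
  exists c; rewrite -[X in I X](subrK (e ^+ M * w)); apply: ID => //.
  by rewrite mulrC; apply: IM.
elim: M {eM} => [|M [c [w [d gw] h]]].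
  exists (fun=> 0), z => //; by rewrite big_ord0 expr0 mul1r subr0 subrr.
have [w' rw' h'] := step w d gw.
exists (fun i => oapp c d (insub (val i))), w' => //.
rewrite big_ord_recr /= insubF ?ltnn //=.
under eq_bigr => i _ do rewrite (_ : insub _ = Some i) ?valK //=.
rewrite exprSr (_ : _ - _ - _ = (z - \sum_(i < M) iota (c i) * e ^+ i - e ^+ M * w)
  + e ^+ M * (w - iota d - e * w')); last by ring.
by apply: ID => //; apply: IM => //; exists (0 ^+ M); exact: germXn.
Qed.
End Germs.

(** * The local algebra of a circuit system *)

Lemma prod_monomial (F : fieldType) (T : finType) (n : nat) (a : 'I_n -> T -> int)
    (z : 'I_n -> F) (e : T -> int) : (forall k, z k != 0) ->
  \prod_j (\prod_k z k ^ a k j) ^ e j = \prod_k z k ^ (\sum_j a k j * e j).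
Proof.
move=> z0; transitivity (\prod_j \prod_k z k ^ (a k j * e j)).
  apply: eq_bigr => j _; elim/big_rec2: _ => [|k u v _ <-]; first exact: exp1rz.
  by rewrite expfzMl exprz_exp.
rewrite exchange_big; apply: eq_bigr => k _.
elim/big_rec2: _ => [|j u v _ ->]; first by rewrite expr0z.
by rewrite expfzDr.
Qed.

Lemma prod_monomial_scale (F : fieldType) (T : finType) (be : F) (u : T -> F)
    (e : T -> int) :
  be != 0 -> \sum_j e j = 0 -> \prod_j (be * u j) ^ e j = \prod_j u j ^ e j.
Proof.
move=> be0 e0.
transitivity (\prod_j be ^ e j * \prod_j u j ^ e j).
  by rewrite -big_split; apply: eq_bigr => j _; rewrite expfzMl.
rewrite (_ : \prod_j be ^ e j = 1) ?mul1r //.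
transitivity (be ^ \sum_j e j); last by rewrite e0 expr0z.
apply: (big_rec2 (fun v w => v = be ^ w)) => [|j v w _ ->]; first by rewrite expr0z.
by rewrite expfzDr.
Qed.

(** [X] are the coordinate functions, of values [x], and [J] is an ideal modulo
which the monomials are [al] times linear forms in a single element [s]. *)
Section CircuitGerms.
Context (R : realType) (K : fieldType) (iota : {rmorphism R -> K}).
Context (germ : K -> R -> Prop).
Hypothesis gP : evaluation iota germ.

Context (T : finType) (n : nat) (X : 'I_n -> K) (x : 'I_n -> R) (a : 'I_n -> T -> int).
Hypothesis x_gt0 : forall k, 0 < x k.
Hypothesis germX : forall k, germ (X k) (x k).
Let y j : K := \prod_k X k ^ a k j.
Let y0 j : R := \prod_k x k ^ a k j.

Context (J : K -> Prop) (th t : T -> R) (al s : K) (al0 s0 : R).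
Hypothesis idealJ : ideal germ J.
Hypothesis t_gt0 : forall j, 0 < t j.
Hypothesis al_gt0 : 0 < al0.
Hypothesis germ_al : germ al al0.
Hypothesis germ_s : germ s s0.
Hypothesis s0_dom : linform_dom th s0.
Hypothesis y0E : forall j, y0 j = al0 * (gale_form th t j).[s0].
Hypothesis yJ : forall j, J (y j - al * (map_poly iota (gale_form th t j)).[s]).

Let ell j := (map_poly iota (gale_form th t j)).[s].
Let tau j := (gale_form th t j).[s0].
Let tau_gt0 j : 0 < tau j. Proof. exact: gale_form_gt0. Qed.
Let tau_neq0 j : tau j != 0. Proof. by rewrite gt_eqF. Qed.
Let al_neq0 : al0 != 0. Proof. by rewrite gt_eqF. Qed.
Let atau_neq0 j : al0 * tau j != 0. Proof. exact: mulf_neq0. Qed.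
Let germ_ell j : germ (ell j) (tau j). Proof. exact: (germ_horner gP). Qed.
Let germ_aell j : germ (al * ell j) (al0 * tau j). Proof. exact: (germM gP). Qed.
Let germ_y j : germ (y j) (y0 j).
Proof.
apply: (germ_prod gP) => k _; apply: (germXz gP) => //.
by rewrite gt_eqF.
Qed.
Let y0_neq0 j : y0 j != 0. Proof. by rewrite y0E; exact: mulf_neq0 al_neq0 (tau_neq0 j). Qed.
Let X_neq0 k : X k != 0. Proof. by apply: (germ_neq0 gP (germX k)); rewrite gt_eqF. Qed.

(** In a product of monomials whose exponents sum to zero the common factor [al]
disappears, so modulo [I] it is a function of [s] alone. *)
Lemma exponent_relation (e : T -> int) (I : K -> Prop) : ideal germ I ->
  (forall z, J z -> I z) -> \sum_j e j = 0 ->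
  I (\prod_k X k ^ (\sum_j a k j * e j) - \prod_j ell j ^ e j).
Proof.
move=> idI JI e0; rewrite -(prod_monomial a _ X_neq0).
rewrite -(prod_monomial_scale ell (germ_neq0 gP germ_al al_neq0) e0).
apply: (congr_prod gP idI).
- by move=> j; exists (y0 j ^ e j); apply: (germXz gP); [exact: y0_neq0|exact: germ_y].
- move=> j; exists ((al0 * tau j) ^ e j).
  by apply: (germXz gP); [exact: atau_neq0|exact: germ_aell].
- move=> j; apply: (congrXz gP idI _ (y0_neq0 j) (atau_neq0 j) (germ_y j) (germ_aell j)).
  by apply: JI; apply: yJ.
Qed.

(** Let [I] be the ideal generated by [J] and [s - s0]. Modulo [I] the power
[X k ^+ N] is a product of monomials with exponents of zero sum, hence congruent
to its value [x k ^+ N]. The quotient of [X k ^+ N - x k ^+ N] by [X k - x k]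
has value [N (x k)^(N-1)], which is nonzero, so it is a unit and
[X k - x k] is in [I]. *)
Lemma uniformizer (N : nat) (m : 'I_n -> T -> int) (k : 'I_n) : (0 < N)%N ->
  \sum_j m k j = 0 ->
  (forall k', \sum_j a k' j * m k j = if k' == k then N%:Z else 0) ->
  exists2 w, regular germ w & J (X k - iota (x k) - (s - iota s0) * w).
Proof.
move=> N0 m0 mE; pose I z := exists2 w, regular germ w & J (z - (s - iota s0) * w).
have idI : ideal germ I by apply: (ideal_adjoin gP).
have [I0 ID IM] := idI; have [J0 JD JM] := idealJ.
have JI z : J z -> I z.
  by exists 0; [exists 0; exact: germ0 gP|rewrite mulr0 subr0].
have Is : I (s - iota s0).
  by exists 1; [exists 1; exact: germ1 gP|rewrite mulr1 subrr].
have XN (F : fieldType) (z : 'I_n -> F) :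
    \prod_k' z k' ^ (\sum_j a k' j * m k j) = z k ^+ N.
  rewrite (bigD1 k) //= mE eqxx big1 ?mulr1 // => k' /negPf kk.
  by rewrite mE kk.
have h1 := exponent_relation idI JI m0; rewrite XN in h1.
have h2 : x k ^+ N = \prod_j tau j ^ m k j.
  rewrite -XN -prod_monomial; last by move=> k'; rewrite gt_eqF.
  rewrite -[RHS](prod_monomial_scale _ al_neq0 m0).
  by apply: eq_bigr => j _; congr (_ ^ _); exact: y0E.
have h3 : I (\prod_j ell j ^ m k j - iota (x k ^+ N)).
  rewrite h2 rmorph_prod /=.
  under [X in _ - X]eq_bigr => j _ do rewrite fmorphXz.
  apply: (congr_prod gP idI).
  - by move=> j; exists (tau j ^ m k j); apply: (germXz gP);
    [exact: tau_neq0|exact: germ_ell].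
  - by move=> j; exists (tau j ^ m k j); apply: (germXz gP);
    [exact: tau_neq0|exact: germC gP _].
  move=> j; apply: (congrXz gP idI _ (tau_neq0 j) (tau_neq0 j) (germ_ell j) (germC gP _)).
  rewrite /ell /tau /gale_form /linform hornerZ !hornerE.
  rewrite -mul_polyC !rmorphM rmorphD !rmorphM /= !rmorph1 !map_polyC map_polyX !hornerE /=.
  rewrite (_ : _ - _ = iota (t j * th j) * (s - iota s0)); last by rewrite rmorphM /=; ring.
  by apply: IM => //; exists (t j * th j); exact: (germC gP).
have h4 := ID _ _ h1 h3; rewrite subrKA rmorphXn subrXX mulrC in h4.
set U := \sum_(i < N) _ in h4.
have gU : germ U (x k ^+ N.-1 *+ N).
  rewrite -[N in _ *+ N]card_ord -sumr_const; apply: (germ_sum gP) => i _.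
  rewrite (_ : x k ^+ N.-1 = x k ^+ (N.-1 - i) * x k ^+ i).
    by apply: (germM gP); apply: (germXn gP); [exact: germX|exact: (germC gP)].
  by rewrite -exprD subnK // -ltnS prednK.
have U0 : x k ^+ N.-1 *+ N != 0 by rewrite mulrn_eq0 negb_or -lt0n N0 /= expf_neq0 // gt_eqF.
have : I (U^-1 * (U * (X k - iota (x k)))).
  by apply: IM => //; exists (x k ^+ N.-1 *+ N)^-1; apply: (germV gP).
by rewrite mulKf // (germ_neq0 gP gU).
Qed.

Lemma univariate_relation (b : T -> int) : \sum_j b j = 0 ->
  (forall k, \sum_j a k j * b j = 0) ->
  J ((map_poly iota (gale_num th t b - gale_den th t b)).[s]).
Proof.
move=> b0 ab; have [J0 JD JM] := idealJ.
have h := exponent_relation idealJ (fun z => id) b0.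
rewrite big1 in h; last by move=> k _; rewrite ab.
rewrite rmorphB /= hornerD hornerN /gale_num /gale_den /gale_monomial.
rewrite !rmorph_prod /= !horner_prod.
under eq_bigr => j _ do rewrite rmorphXn horner_exp -/(ell j).
under [X in _ - X]eq_bigr => j _ do rewrite rmorphXn horner_exp -/(ell j).
set A := \prod_j _; set B := \prod_j _.
have ell0 j : ell j != 0 by exact: (germ_neq0 gP (germ_ell j)).
have B0 : B != 0 by apply/prodf_neq0 => j _; rewrite expf_neq0.
have hE : \prod_j ell j ^ b j = A / B.
  apply: (mulIf B0); rewrite divfK // /A /B -big_split; apply: eq_bigr => j _ /=.
  by rewrite -{1}[b j]pos_partB !exprnP -expfzDr // subrK.
rewrite hE in h.
rewrite (_ : A - B = - B * (1 - A / B)); last by field.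
apply: JM => //; exists (- \prod_j tau j ^+ pos_part (- b j)).
apply: (germN gP); apply: (germ_prod gP) => j _.
exact: (germXn gP).
Qed.

End CircuitGerms.

(** * Germs of rational functions *)

Section RationalGerms.
Context (R : realType) (n : nat) (x : 'rV[R]_n).
Local Notation ratfun := {fraction (mpoly n R)}.
Local Notation ev := (meval (x 0)).

Definition germ_at (z : ratfun) (c : R) : Prop :=
  exists p q : mpoly n R, [/\ ev q != 0, z = tofrac p / tofrac q & c = ev p / ev q].

Definition ratfunC : R -> ratfun := @tofrac (mpoly n R) \o @mpolyC n R.
HB.instance Definition _ := GRing.RMorphism.copy ratfunC (@tofrac (mpoly n R) \o @mpolyC n R).

Lemma tofrac_neq0 q : ev q != 0 -> tofrac q != 0 :> ratfun.
Proof. by move=> q0; rewrite tofrac_eq0; apply: contraNneq q0 => ->; rewrite meval0. Qed.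

Lemma germ_poly p : germ_at (tofrac p) (ev p).
Proof. by exists p, 1; rewrite meval1 oner_eq0 rmorph1 !divr1. Qed.

Lemma germ_atC c : germ_at (ratfunC c) c.
Proof. by rewrite -[X in germ_at _ X](mevalC (x 0)); exact: germ_poly. Qed.

Lemma germ_atX k : germ_at (tofrac (mpolyX R (mnm1 k))) (x 0 k).
Proof. by rewrite -[X in germ_at _ X](mevalXU (x 0)); exact: germ_poly. Qed.

Lemma germ_atD z c z' c' : germ_at z c -> germ_at z' c' -> germ_at (z + z') (c + c').
Proof.
move=> [p [q [q0 -> ->]]] [p' [q' [q0' -> ->]]].
exists (p * q' + p' * q), (q * q'); split; first by rewrite mevalM mulf_neq0.
  by rewrite rmorphD !rmorphM /= addf_div // tofrac_neq0.
by rewrite mevalD !mevalM addf_div.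
Qed.

Lemma germ_atM z c z' c' : germ_at z c -> germ_at z' c' -> germ_at (z * z') (c * c').
Proof.
move=> [p [q [q0 -> ->]]] [p' [q' [q0' -> ->]]].
exists (p * p'), (q * q'); split; first by rewrite mevalM mulf_neq0.
  by rewrite !rmorphM /= mulf_div.
by rewrite !mevalM mulf_div.
Qed.

Lemma germ_atV z c : c != 0 -> germ_at z c -> germ_at z^-1 c^-1.
Proof.
move=> c0 [p [q [q0 zE cE]]]; exists q, p; split.
- by apply: contraNneq c0 => p0; rewrite cE p0 mul0r.
- by rewrite zE invf_div.
- by rewrite cE invf_div.
Qed.

Lemma germ_at0 c : germ_at 0 c -> c = 0.
Proof.
move=> [p [q [q0 /esym/eqP + ->]]].
rewrite mulf_eq0 invr_eq0 (negPf (tofrac_neq0 q0)) orbF tofrac_eq0 => /eqP ->.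
by rewrite meval0 mul0r.
Qed.

Lemma germ_at_neq0 z c : germ_at z c -> c != 0 -> z != 0.
Proof. by move=> gz; apply: contraNneq => z0; apply/eqP/germ_at0; rewrite -z0. Qed.

Lemma evaluation_at : evaluation ratfunC germ_at.
Proof.
split; [exact: germ_atC|exact: germ_atD|exact: germ_atM|exact: germ_atV|].
exact: germ_at_neq0.
Qed.
Local Notation gP := evaluation_at.

Lemma in_local_ringE z : in_local_ring x z <-> regular germ_at z.
Proof.
split=> [[p [q [q0 ->]]]|[c [p [q [q0 -> _]]]]]; last by exists p, q.
by exists (ev p / ev q), p, q.
Qed.

(** The maximal ideal of the local ring at [x] is generated by the differences
[X_k - x_k]: for polynomials this follows by expansion into monomials, and for a
fraction [p / q] of value [c] from the case of [p - c q]. *)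
Lemma germ_maximal (I : ratfun -> Prop) : ideal germ_at I ->
  (forall k, I (tofrac (mpolyX R (mnm1 k)) - ratfunC (x 0 k))) ->
  forall z c, germ_at z c -> I (z - ratfunC c).
Proof.
move=> idI IX; have [I0 ID IM] := idI.
have Ip p : I (tofrac p - ratfunC (ev p)).
  elim/mpolyind: p => [|c m p _ _ IH]; first by rewrite meval0 !rmorph0 subrr.
  rewrite mevalD !rmorphD /= opprD addrACA; apply: ID => // {IH p}.
  rewrite -mul_mpolyC mevalM mevalC !rmorphM /= -mulrBr.
   apply: IM; first by exists c; exact: germ_atC.
  rewrite mevalX rmorph_prod mpolyXE_id rmorph_prod /=.
  under eq_bigr => i _ do rewrite rmorphXn.
  under [X in _ - X]eq_bigr => i _ do rewrite rmorphXn.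
  have gXn i : germ_at (tofrac (mpolyX R (mnm1 i)) ^+ m i) (x 0 i ^+ m i).
    by apply: (germXn gP); exact: germ_atX.
  have gCn i : germ_at (ratfunC (x 0 i) ^+ m i) (x 0 i ^+ m i).
    by apply: (germXn gP); exact: germ_atC.
  apply: (congr_prod gP idI) => i.
  - by eexists; exact: gXn.
  - by eexists; exact: gCn.
  - exact: (congrXn gP idI _ (germ_atX i) (germ_atC _) (IX i)).
move=> z c [p [q [q0 -> ->]]].
have q0' := tofrac_neq0 q0.
have h := Ip (p - (ev p / ev q) *: q).
rewrite mevalB mevalZ divfK // subrr rmorph0 subr0 in h.
rewrite (_ : _ - _ = (tofrac q)^-1 * tofrac (p - (ev p / ev q) *: q)).
  by apply: IM h; exists (ev q)^-1; apply: germ_atV => //; exact: germ_poly.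
rewrite -mul_mpolyC tofracB tofracM mulrBr mulrC; congr (_ - _).
by rewrite mulrCA mulVf // mulr1.
Qed.

Context (m : nat) (f : 'I_m -> ratfun).

Lemma local_ideal : ideal germ_at (in_local_ideal f x).
Proof.
split.
- exists (fun=> 0); split; last by rewrite big1 // => i _; rewrite mul0r.
  by move=> i; apply/in_local_ringE; exists 0; rewrite -(rmorph0 ratfunC); exact: germ_atC.
- move=> u v [h [hl ->]] [h' [hl' ->]]; exists (fun i => h i + h' i); split.
    move=> i; have [c hc] := (in_local_ringE _).1 (hl i).
    have [c' hc'] := (in_local_ringE _).1 (hl' i).
    by apply/in_local_ringE; exists (c + c'); exact: germ_atD.
  by rewrite -big_split; apply: eq_bigr => i _; rewrite mulrDl.
- move=> g u [c gc] [h [hl ->]]; exists (fun i => g * h i); split.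
    move=> i; have [c' hc'] := (in_local_ringE _).1 (hl i).
    by apply/in_local_ringE; exists (c * c'); exact: germ_atM.
  by rewrite mulr_sumr; apply: eq_bigr => i _; rewrite mulrA.
Qed.

Lemma local_ideal_gen i : in_local_ideal f x (f i).
Proof.
exists (fun j => (j == i)%:R); split.
  move=> j; apply/in_local_ringE; exists (j == i)%:R.
  by rewrite -(rmorph_nat ratfunC); exact: germ_atC.
rewrite (bigD1 i) //= eqxx mul1r big1 ?addr0 // => j /negPf ->.
by rewrite mul0r.
Qed.

Lemma local_ideal_germ : (forall i, germ_at (f i) 0) ->
  forall z, in_local_ideal f x z -> germ_at z 0.
Proof.
move=> gf z [h [hl ->]].
have -> : (0 : R) = \sum_(i < m) 0 by rewrite big1.
apply: (germ_sum gP) => i _.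
have [c hc] := (in_local_ringE _).1 (hl i).
by rewrite -(mulr0 c); apply: germ_atM.
Qed.

(** At a solution the ideal consists of functions vanishing at the point, so [1]
is not in it. *)
Lemma multiplicity_ge1 : (forall i, germ_at (f i) 0) -> (1%:E <= multiplicity f x)%E.
Proof.
move=> gf; apply: ereal_sup_ubound; exists 1%N => //.
exists (fun=> 1); split.
  by move=> _; apply/in_local_ringE; exists 1; rewrite -(rmorph1 ratfunC); exact: germ_atC.
move=> t; rewrite big_ord1 mulr1 => /(local_ideal_germ gf) g0 i.
rewrite ord1; have := germ_atD (germ_atC (t ord0)) (germN gP g0).
by rewrite subrr => /germ_at0; rewrite oppr0 addr0.
Qed.

(** Modulo the ideal the algebra is spanned by [M] elements, so a longer family
has a nontrivial linear relation. *)
Lemma multiplicity_le (M : nat) (e : ratfun) :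
  (forall z, regular germ_at z -> exists c : 'I_M -> R,
    in_local_ideal f x (z - \sum_(i < M) ratfunC (c i) * e ^+ i)) ->
  (multiplicity f x <= M%:R%:E)%E.
Proof.
move=> span; apply: ge_ereal_sup => _ [d [g [gl gfree]] <-].
rewrite lee_fin ler_nat leqNgt; apply/negP => Md.
have /choice[c hc] : forall i : 'I_d, exists c : 'I_M -> R,
    in_local_ideal f x (g i - \sum_(l < M) ratfunC (c l) * e ^+ l).
  by move=> i; apply: span; apply/in_local_ringE.
pose A : 'M[R]_(d, M) := \matrix_(i, l) c i l.
have : kermx A != 0.
  by rewrite -mxrank_eq0 mxrank_ker subn_eq0 -ltnNge (leq_ltn_trans (rank_leq_col A)).
case/rowV0Pn => v /sub_kermxP vA; apply/negP; rewrite negbK.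
apply/eqP/rowP => i; rewrite mxE; apply: (gfree (v 0)).
have [I0 ID IM] := local_ideal.
rewrite (_ : \sum_i _ = \sum_i ratfunC (v 0 i) *
    (g i - \sum_(l < M) ratfunC (c i l) * e ^+ l)).
  apply: (big_ind (in_local_ideal f x)) => // j _; apply: IM (hc j).
  by exists (v 0 j); exact: germ_atC.
under [RHS]eq_bigr => j _ do rewrite mulrBr.
rewrite sumrB [X in _ - X](_ : _ = 0) ?subr0 //.
under eq_bigr => j _ do rewrite mulr_sumr.
rewrite exchange_big big1 // => l _.
transitivity (ratfunC ((v *m A) 0 l) * e ^+ l); last by rewrite vA mxE rmorph0 mul0r.
rewrite mxE rmorph_sum mulr_suml; apply: eq_bigr => j _.
by rewrite !mxE rmorphM mulrA.
Qed.

End RationalGerms.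

(** * The lattice of a circuit *)

Section Lattice.
Context (n : nat) (a : 'M[int]_(n, n.+2)).

(** The sum is the expansion, along its first row, of the determinant of [Amat a]
with its row [i] repeated on top, which vanishes. *)
Lemma bvec_relation i : \sum_j Amat a i j * bvec a j = 0.
Proof.
pose B : 'M[int]_n.+2 := col_mx (row i (Amat a)) (Amat a).
have detB : \det B = 0.
  apply: (@determinant_alternate _ _ _ (lshift _ ord0) (rshift 1 i)) => //.
  by move=> j; rewrite /B (col_mxEu (row i (Amat a))) (col_mxEd (row i (Amat a))) mxE.
rewrite -[RHS]detB (expand_det_row _ (lshift n.+1 (ord0 : 'I_1))); apply: eq_bigr => j _.
rewrite /B (col_mxEu (row i (Amat a))) [row _ _ _ _]mxE; congr (_ * _).
rewrite /cofactor /bvec; congr (_ * \det _).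
apply/matrixP => k l; rewrite [LHS]mxE 2![RHS]mxE.
have -> : lift (lshift n.+1 (ord0 : 'I_1)) k = rshift 1 k by apply: val_inj.
by rewrite (col_mxEd (row i (Amat a))).
Qed.

Lemma bvec_sum : \sum_j bvec a j = 0.
Proof.
rewrite -[RHS](bvec_relation (lshift n ord0)); apply: eq_bigr => j _.
by rewrite /Amat col_mxEu mxE mul1r.
Qed.

Lemma bvec_row k : \sum_j a k j * bvec a j = 0.
Proof.
rewrite -[RHS](bvec_relation (rshift 1 k)); apply: eq_bigr => j _.
by rewrite /Amat col_mxEd.
Qed.

(** A vanishing minor gives an affine dependence among the points other than
[a_j], against minimality. *)
Lemma circuit_det_neq0 (R : realType) j : circuit a R -> \det (col' j (Amat a)) != 0.
Proof.
case=> _ min; apply/negP => /eqP det0.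
apply: (min [set~ j]).
  rewrite properE finset.subsetT /=; apply/fintype.subsetPn.
  by exists j; rewrite !inE ?eqxx.
pose M := map_mx (intr : int -> R) (col' j (Amat a)).
have : \det M^T == 0 by rewrite det_tr det_map_mx det0 rmorph0.
case/det0P => v v0 vM.
exists (fun i => oapp (v 0) 0 (unlift j i)); split.
- by have /rV0Pn[i vi] := v0; exists (lift j i); rewrite liftK.
- by move=> i; rewrite !inE negbK => /eqP ->; rewrite unlift_none.
- rewrite (bigD1_ord j) //= unlift_none add0r.
  have := congr1 (fun u : 'rV_(1 + n) => u 0 (lshift n ord0)) vM; rewrite !mxE => h.
  rewrite -[RHS]h; apply: eq_bigr => i _; rewrite liftK /= /M 3!mxE /Amat col_mxEu mxE.
  by rewrite mulr1.
- move=> k; rewrite (bigD1_ord j) //= unlift_none mul0r add0r.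
  have := congr1 (fun u : 'rV_(1 + n) => u 0 (rshift 1 k)) vM; rewrite !mxE => h.
  rewrite -[RHS]h; apply: eq_bigr => i _; rewrite liftK /= /M 3!mxE /Amat.
  by rewrite (col_mxEd (const_mx 1) a k).
Qed.

(** The differences of the points generate a lattice containing [N Z^n], where
[N] is the absolute value of the minor: the coefficients are the entries of the
adjugate matrix. *)
Lemma lattice_multiple : \det (col' ord0 (Amat a)) != 0 ->
  exists N (m : 'I_n -> 'I_n.+2 -> int), [/\ (0 < N)%N,
    forall k, \sum_j m k j = 0 &
    forall k k', \sum_j a k' j * m k j = if k' == k then N%:Z else 0].
Proof.
set D := col' ord0 (Amat a) => D0.
exists `|\det D|%N, (fun k j => oapp (fun i => Num.sg (\det D) * (\adj D) i (rshift 1 k)) 0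
  (unlift ord0 j)).
have key i k : \sum_j Amat a i j *
  oapp (fun i => Num.sg (\det D) * (\adj D) i (rshift 1 k)) 0 (unlift ord0 j) =
  if i == rshift 1 k then `|\det D| else 0.
  rewrite (bigD1_ord ord0) //= unlift_none mulr0 add0r.
  under eq_bigr => l _ do rewrite liftK /= mulrCA.
  rewrite -mulr_sumr.
  have := congr1 (fun u : 'M_(1 + n) => u i (rshift 1 k)) (mul_mx_adj D).
  rewrite !mxE => h.
  rewrite (_ : \sum_l _ = \det D *+ (i == rshift 1 k)).
    by case: (_ == _); rewrite ?mulr0 // normrEsg.
  by rewrite -h; apply: eq_bigr => l _; rewrite [D _ _]mxE.
split; first by rewrite absz_gt0.
- move=> k; have := key (lshift n ord0) k.
  under eq_bigr => j _ do rewrite /Amat col_mxEu mxE mul1r.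
  by move->.
- move=> k k'; have := key (rshift 1 k') k.
  under eq_bigr => j _ do rewrite /Amat (col_mxEd (const_mx 1) a k').
  by move->; rewrite (inj_eq (@rshift_inj _ _)) abszE.
Qed.

(** The row space of [Amat a] is the orthogonal of [bvec a]. *)
Lemma log_solve (R : realType) (u : 'I_n.+2 -> R) :
  \det (col' ord0 (Amat a)) != 0 -> \sum_j (bvec a j)%:~R * u j = 0 ->
  exists c (v : 'I_n -> R), forall j, u j = c + \sum_k v k * (a k j)%:~R.
Proof.
set D := col' ord0 (Amat a) => D0 bu.
pose M := map_mx (intr : int -> R) D.
have Mu : M \in unitmx by rewrite unitmxE unitfE det_map_mx intr_eq0.
have [w wM] : exists w : 'rV_(1 + n), w *m M = \row_i u (lift ord0 i).
  by exists ((\row_i u (lift ord0 i)) *m invmx M); rewrite mulmxKV.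
exists (w 0 (lshift n ord0)), (fun k => w 0 (rshift 1 k)).
pose f j := w 0 (lshift n ord0) + \sum_k w 0 (rshift 1 k) * (a k j)%:~R.
have fl i : u (lift ord0 i) = f (lift ord0 i).
  have /rowP/(_ i) := wM; rewrite mxE [RHS]mxE => <-.
  rewrite big_split_ord /= big_ord1 /f; congr (_ + _).
    by rewrite 2!mxE (col_mxEu (const_mx 1) a) mxE mulr1.
  apply: eq_bigr => k _; congr (_ * _).
  by rewrite 2!mxE (col_mxEd (const_mx 1) a).
have bf : \sum_j (bvec a j)%:~R * f j = 0.
  rewrite /f; under eq_bigr => j _ do rewrite mulrDr mulr_sumr.
  rewrite big_split /= -mulr_suml -(raddf_sum (intmul 1)) bvec_sum mul0r add0r.
  rewrite exchange_big big1 // => k _.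
  transitivity (w 0 (rshift 1 k) * (\sum_j a k j * bvec a j)%:~R).
    by rewrite rmorph_sum mulr_sumr; apply: eq_bigr => j _; rewrite rmorphM /=; ring.
  by rewrite bvec_row mulr0.
move=> j; case: (unliftP ord0 j) => [i ->|->]; first exact: fl.
have : \sum_j (bvec a j)%:~R * (u j - f j) = 0.
  by under eq_bigr => i _ do rewrite mulrBr; rewrite sumrB bu bf subrr.
rewrite (bigD1 ord0) //= big1 ?addr0 => [/eqP|i]; last first.
  by case: (unliftP ord0 i) => [i' ->|->]; rewrite ?eqxx // fl subrr mulr0.
rewrite mulf_eq0 subr_eq0 => /orP[|/eqP //].
by rewrite intr_eq0 /bvec expr0 mul1r (negPf D0).
Qed.

End Lattice.

(** * Gale coordinates *)

Section Gale.
Context (R : realType) (n : nat) (C : 'M[R]_(n, n.+2)) (P : 'M[R]_(n.+2, 2)).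

Lemma det_mx2 (M : 'M[R]_2) : \det M = M 0 0 * M 1 1 - M 0 1 * M 1 0.
Proof.
have l0 : lift (0 : 'I_2) (0 : 'I_1) = 1 by apply: val_inj.
have l1 : lift (1 : 'I_2) (0 : 'I_1) = 0 by apply: val_inj.
rewrite (expand_det_row _ 0) big_ord_recl big_ord1 l0 /cofactor !det_mx11.
by rewrite !mxE l0 l1 /= addn0 expr0 expr1; ring.
Qed.

Lemma pdetE i j : pdet P i j = P i 0 * P j 1 - P i 1 * P j 0.
Proof.
have e0 k : (col_mx (row i P) (row j P) : 'M_2) 0 k = P i k.
  have -> : (0 : 'I_2) = lshift 1 (ord0 : 'I_1) by apply: val_inj.
  by rewrite (col_mxEu (row i P)) mxE.
have e1 k : (col_mx (row i P) (row j P) : 'M_2) 1 k = P j k.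
  have -> : (1 : 'I_2) = rshift 1 (ord0 : 'I_1) by apply: val_inj.
  by rewrite (col_mxEd (row i P)) mxE.
by rewrite /pdet det_mx2 !e0 !e1.
Qed.

(** The vectors [t] and [t * th] form a basis of [ker C], and [gale_span] gives
the coordinates of an element of the kernel in it. They are read off the
entries [j0] and [j1]: explicit formulas are needed because the same ones are
used for vectors of rational functions. *)
Record gale_coordinates (t th : 'I_n.+2 -> R) (j0 j1 : 'I_n.+2) : Prop := {
  gale_t_gt0 : forall j, 0 < t j;
  gale_th0 : th j0 = 0;
  gale_th1 : th j1 != 0;
  gale_ker_t : forall i, \sum_j C i j * t j = 0;
  gale_ker_th : forall i, \sum_j C i j * (t j * th j) = 0;
  gale_span : forall y : 'I_n.+2 -> R, (forall i, \sum_j C i j * y j = 0) ->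
    forall j, y j = y j0 / t j0 * t j + (y j1 / t j1 - y j0 / t j0) / th j1 * (t j * th j) }.

(** Take for [t] the positive vector of [ker C], the image under [P] of some
[w], and for the other basis vector [v_j = ka * det (P_j0, P_j)], where [ka] is
the sign of the ordering. The three-term Plucker relation gives
[t_i v_j - t_j v_i = ka t_j0 det (P_i, P_j)], so the slopes [th = v / t] are
ordered as the rows of [P] are by their determinants. *)
Lemma gale_coordinates_exist (sigma : 'S_n.+2) :
  zero_in_open_cone C -> gale_dual C P -> is_ordering P sigma ->
  exists t th j0 j1, [/\ gale_coordinates t th j0 j1,
    forall i j, gale_eqv P i j = (th i == th j) &
    forall i j : 'I_n.+2, (i < j)%N -> th (sigma i) <= th (sigma j)].
Proof.
move=> [t [t0 tC]] [Pfree PC] [ka kapm ord].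
have kerP (y : 'I_n.+2 -> R) : (forall i, \sum_j C i j * y j = 0) ->
    exists w : 'rV_2, forall j, y j = w 0 0 * P j 0 + w 0 1 * P j 1.
  move=> hy; have : (\row_j y j <= P^T)%MS.
    rewrite PC; apply/sub_kermxP/rowP => i; rewrite !mxE -[RHS](hy i).
    by apply: eq_bigr => j _; rewrite !mxE mulrC.
  case/submxP => w wE; exists w => j.
  have := congr1 (fun u : 'rV_n.+2 => u 0 j) wE; rewrite !mxE => ->.
  rewrite !big_ord_recl big_ord0 addr0 !mxE.
  by rewrite (_ : lift ord0 ord0 = 1) //; apply: val_inj.
have Pker (w0 w1 : R) i : \sum_j C i j * (w0 * P j 0 + w1 * P j 1) = 0.
  have h : P^T *m C^T = 0 by apply/sub_kermxP; rewrite PC.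
  have e k : \sum_j C i j * P j k = 0.
    have := congr1 (fun u : 'M_(2, n) => u k i) h; rewrite !mxE => hk.
    by rewrite -[RHS]hk; apply: eq_bigr => j _; rewrite !mxE mulrC.
  transitivity (w0 * (\sum_j C i j * P j 0) + w1 * (\sum_j C i j * P j 1)).
    by rewrite !mulr_sumr -big_split; apply: eq_bigr => j _ /=; ring.
  by rewrite !e !mulr0 addr0.
have tker i : \sum_j C i j * t j = 0.
  have := congr1 (fun u : 'cV_n => u i 0) tC; rewrite summxE !mxE => h.
  by rewrite -[RHS]h; apply: eq_bigr => j _; rewrite !mxE mulrC.
have [w wE] := kerP t tker.
have ka0 : ka != 0 by case: kapm => ->; rewrite ?oppr_eq0 oner_eq0.
pose j0 : 'I_n.+2 := ord0.
pose v j := ka * pdet P j0 j.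
have tn j : t j != 0 by rewrite gt_eqF.
have thD i j : v j / t j - v i / t i = (ka * pdet P i j) * (t j0 / (t i * t j)).
  have ti := tn i; have tj := tn j.
  apply: (mulfI (mulf_neq0 ti tj)).
  rewrite (_ : t i * t j * (_ - _) = t i * v j - t j * v i); last by field; rewrite ti tj.
  rewrite (_ : t i * t j * (_ * _) = ka * pdet P i j * t j0); last by field; rewrite ti tj.
  by rewrite /v !pdetE !wE; ring.
have [j1 vj1] : exists j1, v j1 != 0.
  apply: contrapT => /forallNP h.
  have h0 j : pdet P j0 j = 0.
    by have /negP := h j; rewrite negbK mulf_eq0 (negPf ka0) => /eqP.
  pose w' : 'rV[R]_2 := \row_k (if k == 0 then - P j0 1 else P j0 0).
  have w'P : w' *m P^T = 0 *m P^T.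
    rewrite mul0mx; apply/rowP => j; rewrite !mxE !big_ord_recl big_ord0 addr0 !mxE /=.
    rewrite (_ : lift ord0 ord0 = 1); last exact: val_inj.
    by rewrite -[RHS](h0 j) pdetE; ring.
  have w'0 := row_free_inj Pfree w'P.
  have p1 : P j0 1 = 0.
    have := congr1 (fun u : 'rV_2 => u 0 0) w'0; rewrite !mxE /= => /eqP.
    by rewrite oppr_eq0 => /eqP.
  have p0 : P j0 0 = 0.
    by have := congr1 (fun u : 'rV_2 => u 0 1) w'0; rewrite !mxE /=.
  by have := tn j0; rewrite wE p0 p1 !mulr0 addr0 eqxx.
exists t, (fun j => v j / t j), j0, j1; split.
- split=> //.
  + by rewrite /v pdetE [P j0 1 * _]mulrC subrr mulr0 mul0r.
  + by rewrite mulf_neq0 ?invr_eq0.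
  + move=> i; rewrite -[RHS](Pker (- ka * P j0 1) (ka * P j0 0) i).
    apply: eq_bigr => j _; congr (_ * _); rewrite mulrC divfK // /v pdetE; ring.
  move=> y hy j; have [z zE] := kerP y hy.
  have tj := tn j; have tj0 := tn j0; have tj1 := tn j1.
  apply: (mulIf vj1); apply: (mulIf tj0).
  rewrite (_ : y j * v j1 * t j0 = y j0 * t j * v j1 + (y j1 * t j0 - y j0 * t j1) * v j).
    by field; rewrite tj tj0 tj1 vj1.
  by rewrite /v !pdetE !zE !wE; ring.
- move=> i j; rewrite /gale_eqv /= -[RHS]subr_eq0 -[v i / _ - _]opprB thD oppr_eq0.
  by rewrite !mulf_eq0 invr_eq0 mulf_eq0 !(negPf (tn _)) (negPf ka0) !orbF.
- move=> i j ij; rewrite -subr_ge0 thD mulr_ge0 ?ord //.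
  by rewrite divr_ge0 ?mulr_ge0 // ltW.
Qed.

End Gale.

(** * Solutions and their multiplicities *)

Lemma expRMz (R : realType) (u : R) (m : int) : expR (m%:~R * u) = expR u ^ m.
Proof.
case: m => k; first by rewrite expRM_natl.
by rewrite NegzE rmorphN mulNr expRN expRM_natl.
Qed.

Section Solutions.
Context (R : realType) (n : nat) (a : 'M[int]_(n, n.+2)) (C : 'M[R]_(n, n.+2)).
Context (t th : 'I_n.+2 -> R) (j0 j1 : 'I_n.+2).
Hypothesis G : gale_coordinates C t th j0 j1.
Hypothesis det0 : \det (col' ord0 (Amat a)) != 0.

Let t_gt0 j : 0 < t j. Proof. exact: gale_t_gt0 G j. Qed.
Let t_neq0 j : t j != 0. Proof. by rewrite gt_eqF. Qed.

(** The coordinates of a vector of the kernel written [al * t * (1 + th * s)]: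
[gale_scale] is [al] and [gale_param] is [s]. They are defined over any field
extending [R], in order to apply both to the values and to the germs of the
monomials. *)
Definition gale_scale (K : fieldType) (iota : R -> K) (Y : 'I_n.+2 -> K) : K :=
  Y j0 / iota (t j0).

Definition gale_param (K : fieldType) (iota : R -> K) (Y : 'I_n.+2 -> K) : K :=
  (Y j1 / iota (t j1) - gale_scale iota Y) / iota (th j1) / gale_scale iota Y.

Lemma horner_gale_form j s : (gale_form th t j).[s] = t j * (1 + th j * s).
Proof. by rewrite hornerZ horner_linform. Qed.

Lemma horner_map_gale_form (K : fieldType) (iota : {rmorphism R -> K}) j s :
  (map_poly iota (gale_form th t j)).[s] = iota (t j) * (1 + iota (th j) * s).
Proof.
rewrite /gale_form /linform -mul_polyC rmorphM rmorphD rmorphM /= rmorph1 !map_polyC map_polyX.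
by rewrite !hornerE.
Qed.

(** The difference is a real linear form in [Y] that vanishes on [ker C], by
[gale_span]; so it is a combination of the rows of [C]. For the monomials, this
puts the difference in the ideal of the system. *)
Lemma gale_relation j : exists h : 'I_n -> R,
  forall (K : fieldType) (iota : {rmorphism R -> K}) (Y : 'I_n.+2 -> K), Y j0 != 0 ->
  Y j - gale_scale iota Y * (map_poly iota (gale_form th t j)).[gale_param iota Y] =
  \sum_i iota (h i) * \sum_l iota (C i l) * Y l.
Proof.
pose r A B : 'rV[R]_n.+2 := \row_l ((l == j)%:R - A * (l == j0)%:R - B * (l == j1)%:R).
have rsum A B (K : fieldType) (iota : {rmorphism R -> K}) (Y : 'I_n.+2 -> K) :
    \sum_l iota (r A B 0 l) * Y l = Y j - iota A * Y j0 - iota B * Y j1.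
  have delta i : \sum_l (l == i)%:R * Y l = Y i.
    rewrite (bigD1 i) //= eqxx mul1r big1 ?addr0 // => l /negPf ->.
    by rewrite mul0r.
  rewrite -[in RHS](delta j) -[in RHS](delta j0) -[in RHS](delta j1).
  rewrite !mulr_sumr -!sumrB; apply: eq_bigr => l _.
  by rewrite mxE !rmorphB !rmorphM !rmorph_nat !mulrBl !mulrA.
pose A := t j / t j0 - t j * th j / (t j0 * th j1).
pose B := t j * th j / (t j1 * th j1).
have : (r A B <= C)%MS.
  rewrite submxE; apply/eqP/rowP => l; rewrite mxE [RHS]mxE.
  pose y i := cokermx C i l.
  have hy i : \sum_j C i j * y j = 0.
    by have := congr1 (fun u : 'M_(n, n.+2) => u i l) (mulmx_coker C); rewrite !mxE.
  transitivity (y j - A * y j0 - B * y j1); first exact: (rsum A B R idfun y).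
  rewrite (gale_span G hy j) /A /B; field.
  by rewrite !t_neq0 (gale_th1 G).
case/submxP => h hE; exists (h 0) => K iota Y Y0.
have it i : iota (t i) != 0 by rewrite fmorph_eq0.
have ith : iota (th j1) != 0 by rewrite fmorph_eq0 (gale_th1 G).
transitivity (\sum_l iota (r A B 0 l) * Y l).
  rewrite rsum horner_map_gale_form /gale_param /gale_scale /A /B.
  rewrite !(rmorphB, rmorphM, fmorphV) /=; field.
  by rewrite !it ith Y0.
rewrite hE; under eq_bigr => l _ do rewrite mxE rmorph_sum mulr_suml.
rewrite exchange_big; apply: eq_bigr => i _; rewrite mulr_sumr.
by apply: eq_bigr => l _; rewrite rmorphM mulrA.
Qed.

Definition monomial_values (x : 'rV[R]_n) (j : 'I_n.+2) : R := \prod_k x 0 k ^ a k j.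
Definition solution_param (x : 'rV[R]_n) : R := gale_param idfun (monomial_values x).

Lemma monomial_values_gt0 (x : 'rV[R]_n) j : (forall k, 0 < x 0 k) -> 0 < monomial_values x j.
Proof. by move=> x0; apply: prodr_gt0 => k _; rewrite exprz_gt0. Qed.

Section AtSolution.
Context (x : 'rV[R]_n).
Hypothesis xsol : pos_solution a C x.
Let x0 k : 0 < x 0 k. Proof. by case: xsol. Qed.
Let al0 := gale_scale idfun (monomial_values x).
Let al0_gt0 : 0 < al0.
Proof. by apply: divr_gt0; [exact: monomial_values_gt0|exact: t_gt0]. Qed.

Lemma monomial_valuesE j :
  monomial_values x j = al0 * (gale_form th t j).[solution_param x].
Proof.
have [h] := gale_relation j.
move/(_ _ (idfun : {rmorphism R -> R}) (monomial_values x)).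
rewrite map_poly_id // gt_eqF ?monomial_values_gt0 // => /(_ isT)/eqP.
rewrite big1 ?subr_eq0 => [/eqP //|i _].
by have [_ /(_ i) e] := xsol; rewrite [X in _ * X]e mulr0.
Qed.

Lemma solution_param_dom : linform_dom th (solution_param x).
Proof.
apply/forallP => j; have := monomial_values_gt0 j x0.
by rewrite monomial_valuesE pmulr_rgt0 // hornerZ pmulr_rgt0.
Qed.

Local Notation ratfun := {fraction (mpoly n R)}.
Let iota : {rmorphism R -> ratfun} := @ratfunC R n.
Let X (k : 'I_n) : ratfun := tofrac (mpolyX R (mnm1 k)).
Let Y (j : 'I_n.+2) : ratfun := \prod_k X k ^ a k j.
Let s0 := solution_param x.
Let gP := evaluation_at x.
Let gX := germ_atX x.

Let germ_Y j : germ_at x (Y j) (monomial_values x j).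
Proof.
apply: (germ_prod gP) => k _; apply: (germXz gP); last exact: gX.
by rewrite gt_eqF.
Qed.

Lemma germ_laurent i : germ_at x (laurent a C i) 0.
Proof.
have [_ /(_ i) <-] := xsol; apply: (germ_sum gP) => j _.
by apply: (germM gP); [exact: (germC gP)|exact: germ_Y].
Qed.

Let germ_al : germ_at x (gale_scale iota Y) al0.
Proof.
apply: (germM gP); first exact: germ_Y.
by apply: (germV gP); [exact: t_neq0|exact: (germC gP)].
Qed.

Let germ_s : germ_at x (gale_param iota Y) s0.
Proof.
apply: (germM gP); last by apply: (germV gP); [rewrite gt_eqF|exact: germ_al].
apply: (germM gP); last by apply: (germV gP); [exact: gale_th1 G|exact: (germC gP)].
apply: (germD gP); last by apply: (germN gP); exact: germ_al.
apply: (germM gP); first exact: germ_Y.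
by apply: (germV gP); [exact: t_neq0|exact: (germC gP)].
Qed.

Let idJ := local_ideal x (laurent a C).

Let yJ j : in_local_ideal (laurent a C) x
  (Y j - gale_scale iota Y * (map_poly iota (gale_form th t j)).[gale_param iota Y]).
Proof.
have [h ->] := gale_relation j; last first.
  by apply: (germ_at_neq0 (germ_Y j0)); rewrite gt_eqF // monomial_values_gt0.
have [J0 JD JM] := idJ.
apply: (big_ind (in_local_ideal (laurent a C) x)) => // i _.
by apply: JM; [exists (h i); exact: (germC gP)|exact: local_ideal_gen].
Qed.

Lemma multiplicity_ge1_solution : (1%:E <= multiplicity (laurent a C) x)%E.
Proof. by apply: multiplicity_ge1; exact: germ_laurent. Qed.

(** Write [F = (X - s0)^m H] with [H(s0)] nonzero. As [F(s)] is in the ideal and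
[H(s)] is a unit, [(s - s0)^m] is in the ideal, and [nilpotent_span] applies to
[s - s0]. *)
Lemma multiplicity_le_mup :
  gale_num th t (bvec a) - gale_den th t (bvec a) != 0 ->
  (multiplicity (laurent a C) x <=
   (mup s0 (gale_num th t (bvec a) - gale_den th t (bvec a)))%:R%:E)%E.
Proof.
set F := _ - _ => F0.
have [m [H]] := multiplicity_XsubC F s0; rewrite F0 /= => Hs FE.
have -> : mup s0 F = m by rewrite FE mupMr // mup_XsubCX eqxx.
have [J0 JD JM] := idJ.
have FJ : in_local_ideal (laurent a C) x (map_poly iota F).[gale_param iota Y].
  exact: (univariate_relation gP x0 gX idJ t_gt0 al0_gt0
    germ_al germ_s solution_param_dom monomial_valuesE yJ (bvec_sum a) (bvec_row a)).
have [N [l [N0 l0 lE]]] := lattice_multiple det0.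
apply: (multiplicity_le (e := gale_param iota Y - iota s0)).
apply: (nilpotent_span gP idJ).
- rewrite -(subrr s0); apply: (germD gP); first exact: germ_s.
  by apply: (germN gP); exact: (germC gP).
- move=> z c gz.
  apply: (germ_maximal (I := fun z => exists2 w, regular (germ_at x) w &
    in_local_ideal (laurent a C) x (z - (gale_param iota Y - iota s0) * w))) gz.
    exact: (ideal_adjoin gP _ idJ).
  move=> k.
  exact: (uniformizer gP x0 gX idJ t_gt0 al0_gt0
    germ_al germ_s solution_param_dom monomial_valuesE yJ N0 (l0 k) (lE k)).
have gH : germ_at x (map_poly iota H).[gale_param iota Y] H.[s0].
  exact: (germ_horner gP).
have Hn : (map_poly iota H).[gale_param iota Y] != 0 by exact: (germ_at_neq0 gH).
rewrite FE rmorphM rmorphXn rmorphB /= map_polyX map_polyC in FJ.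
rewrite hornerM horner_exp hornerXsubC in FJ.
rewrite -[_ ^+ m](mulKf Hn); apply: JM FJ.
by exists (H.[s0])^-1; apply: (germV gP).
Qed.

End AtSolution.

(** The positive number [x_k] is determined by its power [x_k ^+ N], a product of
values of monomials with exponents of zero sum, which only depends on the
parameter. *)
Lemma solution_param_inj (x x' : 'rV[R]_n) : pos_solution a C x -> pos_solution a C x' ->
  solution_param x = solution_param x' -> x = x'.
Proof.
move=> xs xs' e; have [N [l [N0 l0 lE]]] := lattice_multiple det0.
have xN (z : 'rV[R]_n) k : pos_solution a C z ->
    z 0 k ^+ N = \prod_j (gale_form th t j).[solution_param z] ^ l k j.
  move=> zs; have z0 i : z 0 i != 0 by rewrite gt_eqF //; case: zs.
  have al_neq0 : gale_scale idfun (monomial_values z) != 0.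
    by rewrite mulf_neq0 ?invr_neq0 ?t_neq0 // gt_eqF // monomial_values_gt0 //; case: zs.
  rewrite -(prod_monomial_scale _ al_neq0 (l0 k)).
  under eq_bigr => j _ do rewrite -(monomial_valuesE zs).
  rewrite (prod_monomial (fun k j => a k j)) // (bigD1 k) //=.
  rewrite lE eqxx big1 ?mulr1 // => i /negPf ik.
  by rewrite lE ik.
apply/rowP => k; have [x0 _] := xs; have [x0' _] := xs'.
apply: (@pexpIrn _ N) => //; rewrite ?nnegrE ?ltW //.
by rewrite !xN // e.
Qed.

(** In logarithms, the equation says that the vector [ln (gale_form j)] is
orthogonal to [bvec a]; so it is an affine function of the [a_j], whose linear
part is the logarithm of the solution. *)
Lemma solution_of_param s : linform_dom th s ->
  (gale_num th t (bvec a)).[s] = (gale_den th t (bvec a)).[s] ->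
  exists2 x, pos_solution a C x & solution_param x = s.
Proof.
move=> Is e.
have L0 j : 0 < (gale_form th t j).[s] by exact: gale_form_gt0.
pose u j := ln (gale_form th t j).[s].
have uE j : expR (u j) = (gale_form th t j).[s] by rewrite /u lnK ?posrE.
have bu : \sum_j (bvec a j)%:~R * u j = 0.
  apply: expR_inj; rewrite expR0 expR_sum.
  have D0 : (gale_den th t (bvec a)).[s] != 0 by rewrite gt_eqF // gale_monomial_gt0.
  apply: (mulIf D0); rewrite mul1r -[RHS]e !horner_prod -big_split; apply: eq_bigr => j _.
  rewrite expRMz uE !horner_exp /= -{1}[bvec a j]pos_partB !exprnP -expfzDr ?subrK //.
  by rewrite gt_eqF.
have [c [v uv]] := log_solve det0 bu.
pose x : 'rV[R]_n := \row_k expR (v k).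
have xE j : monomial_values x j = expR (- c) * (gale_form th t j).[s].
  rewrite -uE -expRD uv addKr expR_sum; apply: eq_bigr => k _.
  by rewrite mxE mulrC expRMz.
exists x.
  split=> [k|i]; first by rewrite mxE expR_gt0.
  transitivity (expR (- c) * (\sum_j C i j * t j + s * \sum_j C i j * (t j * th j))).
    rewrite mulrDr !mulr_sumr -big_split; apply: eq_bigr => j _.
    by rewrite -/(monomial_values x j) xE horner_gale_form /=; ring.
  by rewrite (gale_ker_t G) (gale_ker_th G) mulr0 addr0 mulr0.
rewrite /solution_param /gale_param /gale_scale !xE !horner_gale_form.
rewrite (gale_th0 G) mul0r addr0 mulr1 /=.
by field; rewrite !t_neq0 (gale_th1 G) expR_eq0.
Qed.
End Solutions.

(** * Equivalence classes and partial sums *)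

Section ClassIndex.
Context (R : realType) (n : nat) (P : 'M[R]_(n.+2, 2)) (th : 'I_n.+2 -> R).
Context (sigma : 'S_n.+2) (K : {set 'I_n.+2}) (sbar : 'I_#|gale_classes P| -> 'I_n.+2).
Hypothesis eqvE : forall i j, gale_eqv P i j = (th i == th j).
Hypothesis th_mono : forall i j : 'I_n.+2, (i < j)%N -> th (sigma i) <= th (sigma j).
Hypothesis K_repr : representatives P K.
Hypothesis sbar_ord : induced_strict_ordering sigma K sbar.

Lemma gale_classE i j : (j \in gale_class P i) = (th i == th j).
Proof. by rewrite inE eqvE. Qed.

Lemma sbar_surj j : exists l, th (sbar l) = th j.
Proof.
have [_ sK _] := sbar_ord.
have /eqP/cards1P[i iE] : #|K :&: gale_class P j| = 1%N.
  by apply: K_repr; apply/imsetP; exists j; rewrite ?inE.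
have : i \in K :&: gale_class P j by rewrite iE inE.
rewrite inE gale_classE -sK => /andP[/imsetP[l _ ->] /eqP e].
by exists l.
Qed.

Lemma sbar_inj l l' : th (sbar l) = th (sbar l') -> l = l'.
Proof.
have [inj sK _] := sbar_ord => e; apply: inj.
have /eqP/cards1P[i iE] : #|K :&: gale_class P (sbar l)| = 1%N.
  by apply: K_repr; apply/imsetP; exists (sbar l); rewrite ?inE.
have sKl m : sbar m \in K by rewrite -sK; apply/imsetP; exists m; rewrite ?inE.
have : sbar l \in [set i] by rewrite -iE inE gale_classE eqxx sKl.
have : sbar l' \in [set i] by rewrite -iE inE gale_classE e eqxx sKl.
by rewrite !inE => /eqP -> /eqP ->.
Qed.

Lemma sbar_mono (l l' : 'I_#|gale_classes P|) : (l <= l')%N -> th (sbar l) <= th (sbar l').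
Proof.
rewrite leq_eqVlt => /orP[/eqP/val_inj -> //|ll].
have [_ _ lt] := sbar_ord.
have := lt _ _ ll (sigma^-1 (sbar l))%g (sigma^-1 (sbar l'))%g.
rewrite !permKV !gale_classE !eqxx => /(_ isT isT) /th_mono.
by rewrite !permKV.
Qed.

Definition class_index j : 'I_#|gale_classes P| := projT1 (cid (sbar_surj j)).

Lemma class_indexK j : th (sbar (class_index j)) = th j.
Proof. by rewrite /class_index; case: cid. Qed.

Lemma mu_partial_sum (a : 'M[int]_(n, n.+2)) :
  mu a sbar = class_partial_sum (bvec a) class_index.
Proof.
apply/funext => l; rewrite /mu /class_partial_sum; apply: eq_bigl => j.
apply/finset.bigcupP/idP => [[m ml]|h].
  by rewrite gale_classE -(class_indexK j) => /eqP e; rewrite -(sbar_inj e).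
by exists (class_index j) => //; rewrite gale_classE class_indexK.
Qed.

End ClassIndex.

(** * Sums over the solution set *)

Section Count.
Context (R : realType) (T : choiceType) (S : set T) (f : T -> \bar R).

Lemma esum_le_nat (N : nat) (m : T -> nat) :
  (forall x, S x -> (f x <= (m x)%:R%:E)%E) ->
  (forall s : seq T, uniq s -> (forall x, x \in s -> S x) -> (\sum_(x <- s) m x <= N)%N) ->
  (\esum_(x in S) f x <= N%:R%:E)%E.
Proof.
move=> fm bound; apply: ge_ereal_sup => _ [A [finA AS] <-].
rewrite fsbig_finite //=.
have inS x : x \in fset_set A -> S x by rewrite in_fset_set // inE => /AS.
apply: (@le_trans _ _ (\sum_(x <- fset_set A) (m x)%:R%:E)%E).
  rewrite big_seq [leRHS]big_seq; apply: lee_sum => x xA.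
  exact/fm/inS.
by rewrite sumEFin lee_fin -natr_sum ler_nat; apply: bound => //; exact: fset_uniq.
Qed.

Lemma esum_infinite (g : nat -> T) : injective g -> (forall i, S (g i)) ->
  (forall x, S x -> (1%:E <= f x)%E) -> (\esum_(x in S) f x = +oo)%E.
Proof.
move=> ginj gS f1; apply/eqyP => r r0.
pose d := Num.truncn r; pose s := map g (iota 0 d.+1).
apply: (@le_trans _ _ (d.+1%:R%:E)%E).
  by rewrite lee_fin ltW // truncnS_gt.
apply: esum_ge; exists [set` s]%classic.
  by split=> // x /= /mapP[i _ ->].
rewrite -fsbig_seq; last by rewrite map_inj_uniq ?iota_uniq.
apply: (@le_trans _ _ (\sum_(x <- s) 1%:E)%E).
  by rewrite sumEFin big_const_seq count_predT size_map size_iota iter_addr addr0 lexx.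
rewrite big_seq [leRHS]big_seq; apply: lee_sum => x /mapP[i _ ->].
exact/f1/gS.
Qed.

End Count.

(** Any [s] whose inverse exceeds the sum of the absolute slopes is in the
domain. *)
Lemma linform_dom_infinite (R : realType) (T : finType) (th : T -> R) :
  exists2 s : nat -> R, injective s & forall i, linform_dom th (s i).
Proof.
pose M := \sum_j `|th j|.
have M0 : 0 <= M by apply: sumr_ge0.
have pos i : 0 < M + i.+1%:R by rewrite ltr_wpDl // ltr0n.
exists (fun i => (M + i.+1%:R)^-1).
  by move=> i j /invr_inj/addrI/eqP; rewrite eqr_nat eqSS => /eqP.
move=> i; apply/forallP => j; rewrite horner_linform.
have tM : `|th j| <= M by rewrite /M (bigD1 j) //= lerDl sumr_ge0.
have h := lerNnormlW (lexx `|th j|).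
rewrite -(pmulr_lgt0 _ (pos i)) mulrDl mulfVK ?gt_eqF // mul1r.
have : 0 < i.+1%:R :> R by rewrite ltr0n.
by move: h tM; lra.
Qed.

(** * The bound *)

Theorem theorem2p4 (R : realType) (n : nat) (a : 'M[int]_(n, n.+2))
    (C : 'M[R]_(n, n.+2)) (P : 'M[R]_(n.+2, 2)) (sigma : 'S_n.+2)
    (K : {set 'I_n.+2}) (sbar : 'I_#|gale_classes P| -> 'I_n.+2)
    (a_inj : injective (fun j : 'I_n.+2 => col j a))
    (a_dim : conv_dim a R = n)
    (a_circuit : circuit a R)
    (C_rank : \rank C = n)
    (C_cone : zero_in_open_cone C)
    (CP : gale_dual C P)
    (sigma_ord : is_ordering P sigma)
    (K_repr : representatives P K)
    (sbar_ord : induced_strict_ordering sigma K sbar)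
    (npos_fin : (npos a C < +oo)%E) :
  (npos a C <= (1 + sgnvar (mu a sbar))%:R%:E)%E.
Proof.
have [t [th [j0 [j1 [G eqvE th_mono]]]]] := gale_coordinates_exist C_cone CP sigma_ord.
have det0 := circuit_det_neq0 ord0 a_circuit.
have t_gt0 := gale_t_gt0 G.
have [F0|F0] := eqVneq (gale_num th t (bvec a) - gale_den th t (bvec a)) 0.
  have [s sinj sdom] := linform_dom_infinite th.
  have /choice[x xP] i : exists x, pos_solution a C x /\ solution_param a t th j0 j1 x = s i.
    have e : (gale_num th t (bvec a)).[s i] = (gale_den th t (bvec a)).[s i].
      by congr (_.[_]); apply/eqP; rewrite -subr_eq0 F0.
    by have [x ? ?] := solution_of_param G det0 (sdom i) e; exists x.
  have xinj : injective x.
    by move=> i i' e; apply: sinj; rewrite -(xP i).2 -(xP i').2 e.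
  move: npos_fin; rewrite /npos (esum_infinite xinj) ?ltxx //.
    by move=> i; have [] := xP i.
  by move=> z /= zsol; exact: multiplicity_ge1_solution zsol.
rewrite (mu_partial_sum eqvE K_repr sbar_ord).
apply: (esum_le_nat (fun z zsol => multiplicity_le_mup G det0 zsol F0)) => s us sS.
have := zeros_le_univariate t_gt0 (bvec_sum a) (class_indexK eqvE K_repr sbar_ord)
  (sbar_mono eqvE th_mono sbar_ord) F0.
move/(_ (map (solution_param a t th j0 j1) s)); rewrite big_map add1n; apply.
  rewrite map_inj_in_uniq // => z z' /sS zs /sS zs'.
  exact: solution_param_inj G det0 _ _ zs zs'.
by apply/allP => _ /mapP[z /sS zs ->]; apply: (solution_param_dom G); exact: zs.
Qed.
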